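(* The canonical functor $(\Sigma_\Omega)_{\mathrm{contr}}\to\mathrm{Aut}(\Omega)$, which sends $\sigma\in\Sigma_\Omega$ to $F_\sigma$, is an isomorphism of categories. In particular, the category $\mathrm{Aut}(\Omega)$ of autoequivalences of $\Omega$ is a contractible groupoid (i.e. a groupoid equivalent to the terminal category).
   Context: For a category $A$, $\mathrm{Aut}(A)$ is the category of autoequivalences of $A$: the full subcategory, on the equivalences, of the category of endofunctors of $A$ and natural transformations. **The canonical functor.** For a small category $A$, $\Sigma_A$ is the group $\prod_{a\in\mathrm{Ob}(A)}\mathrm{aut}_A(a)$, where $\mathrm{aut}_A(a)$ is the automorphism group of $a$. For $\sigma=(\sigma_a)\in\Sigma_A$, $F_\sigma:A\to A$ is the functor which is the identity on objects and sends $f:a\to b$ to $\sigma_bf\sigma_a^{-1}$. For $\sigma,\sigma'\in\Sigma_A$ there is a natural isomorphism $F_\sigma\to F_{\sigma'}$ with component $\sigma'_a\sigma_a^{-1}$ at $a$. $(\Sigma_A)_{\mathrm{contr}}$ is the groupoid with object set $\Sigma_A$ and exactly one morphism between any two objects. The canonical functor $(\Sigma_A)_{\mathrm{contr}}\to\mathrm{Aut}(A)$ sends $\sigma$ to $F_\sigma$ and the unique morphism $\sigma\to\sigma'$ to the natural isomorphism above. **The category $\Omega$.** $\mathrm{Op}$ is the category of small symmetric coloured operads in sets. A combinatorial tree is a non-empty finite connected graph with no loops (cycles); a vertex is outer if exactly one edge is attached to it. An (operadic) tree is a combinatorial tree with a chosen outer vertex, the output, and a chosen (possibly empty) set of other outer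 vertices, the inputs. Its vertices are the vertices of the graph that are neither inputs nor the output; its edges are those of the graph. It is oriented from the inputs to the output, so each vertex has one output edge and a finite set of input edges. For a tree $T$, $\Omega(T)$ is the free symmetric operad whose colours are the edges of $T$, generated by one operation $(e_1,\dots,e_m)\to e$ for each vertex with output edge $e$ and each ordering $e_1<\dots<e_m$ of its input edges, the symmetric group permuting these generators in the obvious way. The category $\Omega$ has as objects trees up to isomorphism (up to renaming vertices and edges) and $\Omega(S,T)=\mathrm{Op}(\Omega(S),\Omega(T))$. *)

(* Defs.v *)
From HB Require Import structures.
From Stdlib Require List.
From mathcomp Require Import all_boot.
From mathcomp Require Import boolp.

Set Implicit Arguments.
Unset Strict Implicit.
Unset Printing Implicit Defensive.
Import generic_quotient.
#[local] Obligation Tactic := idtac.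

Record category : Type := Category {
  ob :> Type;
  hom : ob -> ob -> Type;
  idm : forall a, hom a a;
  cmp : forall a b c, hom b c -> hom a b -> hom a c;
  cmp1m : forall a b (f : hom a b), cmp (idm b) f = f;
  cmpm1 : forall a b (f : hom a b), cmp f (idm a) = f;
  cmpA : forall a b c d (h : hom c d) (g : hom b c) (f : hom a b),
    cmp h (cmp g f) = cmp (cmp h g) f }.

Notation "g \oc f" := (cmp g f) (at level 40, left associativity).

Definition is_isom (A : category) (a b : A) (f : hom a b) : Prop :=
  exists g : hom b a, g \oc f = idm a /\ f \oc g = idm b.

Definition is_groupoid (A : category) : Prop :=
  forall (a b : A) (f : hom a b), is_isom f.

Record functor (A B : category) : Type := Functor {
  fob :> A -> B;
  fmap : forall a b : A, hom a b -> hom (fob a) (fob b);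
  fmap1 : forall a : A, fmap (idm a) = idm (fob a);
  fmapM : forall (a b c : A) (g : hom b c) (f : hom a b),
    fmap (g \oc f) = fmap g \oc fmap f }.

Definition functor_id (A : category) : functor A A :=
  @Functor A A (fun a => a) (fun _ _ f => f)
    (fun _ => erefl) (fun _ _ _ _ _ => erefl).

Program Definition functor_comp (A B C : category)
    (G : functor B C) (F : functor A B) : functor A C :=
  @Functor A C (fun a => G (F a)) (fun _ _ f => fmap G (fmap F f)) _ _.
Next Obligation. by move=> * /=; rewrite !fmap1. Qed.
Next Obligation. by move=> * /=; rewrite !fmapM. Qed.

Definition iso_of_categories (A B : category) (F : functor A B) : Prop :=
  exists G : functor B A,
    functor_comp G F = functor_id A /\ functor_comp F G = functor_id B.

Record nat_trans (A B : category) (F G : functor A B) : Type := NatTrans {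
  component :> forall a : A, hom (F a) (G a);
  naturality : forall (a b : A) (f : hom a b),
    component b \oc fmap F f = fmap G f \oc component a }.

Lemma nat_trans_ext (A B : category) (F G : functor A B)
    (t u : nat_trans F G) : (forall a, t a = u a) -> t = u.
Proof.
case: t u => [t tP] [u uP] /= tu.
have {}tu : t = u by apply: functional_extensionality_dep.
by rewrite -tu in uP *; congr NatTrans; apply: Prop_irrelevance.
Qed.

Program Definition nat_id (A B : category) (F : functor A B) :
    nat_trans F F :=
  @NatTrans A B F F (fun a => idm (F a)) _.
Next Obligation. by move=> * /=; rewrite cmp1m cmpm1. Qed.

Program Definition nat_comp (A B : category) (F G H : functor A B)
    (u : nat_trans G H) (t : nat_trans F G) : nat_trans F H :=
  @NatTrans A B F H (fun a => u a \oc t a) _.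
Next Obligation.
by move=> *; rewrite -cmpA naturality cmpA naturality cmpA.
Qed.

Program Definition functor_cat (A B : category) : category :=
  @Category (functor A B) (@nat_trans A B) (@nat_id A B) (@nat_comp A B)
    _ _ _.
Next Obligation. by move=> *; apply: nat_trans_ext => x /=; apply: cmp1m. Qed.
Next Obligation. by move=> *; apply: nat_trans_ext => x /=; apply: cmpm1. Qed.
Next Obligation. by move=> *; apply: nat_trans_ext => x /=; apply: cmpA. Qed.

Definition nat_isomorphic (A B : category) (F G : functor A B) : Prop :=
  exists t : @hom (functor_cat A B) F G, is_isom t.

Definition is_equivalence (A B : category) (F : functor A B) : Prop :=
  exists G : functor B A,
    nat_isomorphic (functor_comp G F) (functor_id A) /\
    nat_isomorphic (functor_comp F G) (functor_id B).

Definition equivalent (A B : category) : Prop :=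
  exists F : functor A B, is_equivalence F.

Definition full_subcat (A : category) (P : A -> Prop) : category :=
  @Category {a : A | P a} (fun a b => hom (sval a) (sval b))
    (fun a => idm (sval a)) (fun _ _ _ g f => g \oc f)
    (fun _ _ f => cmp1m f) (fun _ _ f => cmpm1 f)
    (fun _ _ _ _ h g f => cmpA h g f).

Definition Aut (A : category) : category :=
  @full_subcat (functor_cat A A) (@is_equivalence A A).

Definition contr (X : Type) : category :=
  @Category X (fun _ _ => unit) (fun _ => tt) (fun _ _ _ _ _ => tt)
    (fun _ _ f => let: tt := f in erefl) (fun _ _ f => let: tt := f in erefl)
    (fun _ _ _ _ _ _ _ => erefl).

Definition terminal : category := contr unit.

Definition contractible_groupoid (A : category) : Prop :=
  is_groupoid A /\ equivalent A terminal.

Record aut (A : category) (a : A) : Type := MkAut {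
  aut_val :> hom a a;
  aut_inv : hom a a;
  aut_mulVm : aut_inv \oc aut_val = idm a;
  aut_mulmV : aut_val \oc aut_inv = idm a }.

Definition Sigma (A : category) : Type := forall a : A, aut a.

Section Canonical.
Variable A : category.
Implicit Types s t : Sigma A.

Program Definition Fsigma s : functor A A :=
  @Functor A A (fun a => a) (fun a b f => (s b \oc f) \oc aut_inv (s a)) _ _.
Next Obligation. by move=> s a /=; rewrite cmpm1 aut_mulmV. Qed.
Next Obligation.
move=> s a b c g f /=.
by rewrite -!cmpA; congr (_ \oc (_ \oc _)); rewrite !cmpA aut_mulVm cmp1m.
Qed.

Program Definition sigma_iso s t : nat_trans (Fsigma s) (Fsigma t) :=
  @NatTrans A A (Fsigma s) (Fsigma t) (fun a => t a \oc aut_inv (s a)) _.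
Next Obligation.
move=> s t a b f /=.
rewrite -!cmpA; congr (_ \oc _); rewrite !cmpA aut_mulVm cmp1m.
by rewrite -2!cmpA; congr (_ \oc _); rewrite cmpA aut_mulVm cmp1m.
Qed.

Lemma sigma_iso_id s : sigma_iso s s = nat_id (Fsigma s).
Proof. by apply: nat_trans_ext => a /=; rewrite aut_mulmV. Qed.

Lemma sigma_iso_comp s t u :
  sigma_iso s u = nat_comp (sigma_iso t u) (sigma_iso s t).
Proof.
apply: nat_trans_ext => a /=.
by rewrite -cmpA; congr (_ \oc _); rewrite cmpA aut_mulVm cmp1m.
Qed.

Lemma Fsigma_equiv s : is_equivalence (Fsigma s).
Proof.
have to_id : forall a b (f : hom a b),
    aut_inv (s b) \oc ((s b \oc f) \oc aut_inv (s a)) = f \oc aut_inv (s a).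
  by move=> a b f; rewrite !cmpA aut_mulVm cmp1m.
have from_id : forall a b (f : hom a b),
    s b \oc f = ((s b \oc f) \oc aut_inv (s a)) \oc s a.
  by move=> a b f; rewrite -!cmpA aut_mulVm cmpm1.
exists (functor_id A); split.
  exists (@NatTrans A A (functor_comp (functor_id A) (Fsigma s)) (functor_id A)
           (fun a => aut_inv (s a)) to_id).
  exists (@NatTrans A A (functor_id A) (functor_comp (functor_id A) (Fsigma s))
           (fun a => s a) from_id).
  by split; apply: nat_trans_ext => a /=; rewrite ?aut_mulVm ?aut_mulmV.
exists (@NatTrans A A (functor_comp (Fsigma s) (functor_id A)) (functor_id A)
         (fun a => aut_inv (s a)) to_id).
exists (@NatTrans A A (functor_id A) (functor_comp (Fsigma s) (functor_id A))
         (fun a => s a) from_id).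
by split; apply: nat_trans_ext => a /=; rewrite ?aut_mulVm ?aut_mulmV.
Qed.

Definition canonical_functor : functor (contr (Sigma A)) (Aut A) :=
  @Functor (contr (Sigma A)) (Aut A)
    (fun s => exist _ (Fsigma s) (Fsigma_equiv s))
    (fun s t _ => sigma_iso s t)
    sigma_iso_id (fun s t u _ _ => sigma_iso_comp s t u).

End Canonical.

(* A permutation of {0, .., n-1} is the sequence s of its values;
   [reord xs s] is [:: xs_(s 0); ..; xs_(s (n-1))].  In particular
   [reord s t] is the composite permutation i |-> s (t i). *)
Definition is_perm (n : nat) (s : seq nat) : bool := perm_eq s (iota 0 n).

Definition reord (T : Type) (xs : seq T) (s : seq nat) : seq T :=
  pmap (onth xs) s.

(* The partition of 0, 1, 2, .. into consecutive blocks of lengths ns. *)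
Definition blocks (ns : seq nat) : seq (seq nat) :=
  reshape ns (iota 0 (sumn ns)).

Definition block_perm (ns s : seq nat) : seq nat :=
  flatten (reord (blocks ns) s).

Definition perm_sum (ns : seq nat) (ts : seq (seq nat)) : seq nat :=
  flatten [seq reord p.1 p.2 | p <- zip (blocks ns) ts].

Section ReordTheory.

Lemma all_flatten T (a : pred T) ss : all a (flatten ss) = all (all a) ss.
Proof. by elim: ss => //= s ss IH; rewrite all_cat IH. Qed.

Lemma reord_map T U (f : T -> U) xs s :
  reord (map f xs) s = map f (reord xs s).
Proof.
rewrite /reord; elim: s => //= i s ->; rewrite onth_map.
by case: (onth xs i).
Qed.

Lemma reord_flatten T (xs : seq T) ss :
  reord xs (flatten ss) = flatten (map (reord xs) ss).
Proof. by elim: ss => //= s ss <-; rewrite /reord pmap_cat. Qed.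

Lemma reordM T (xs : seq T) s t : all (gtn (size xs)) s ->
  reord xs (reord s t) = reord (reord xs s) t.
Proof.
case: xs => [|x xs'].
  by case: s => //= _; rewrite /reord /=; elim: t => //= i t; case: i.
set xs := x :: xs' => sP.
have -> : reord xs s = map (nth x xs) s.
  elim: s sP => //= i s IH /andP[ilt /IH].
  by rewrite /reord /= => ->; rewrite onthE (nth_map x).
rewrite reord_map; elim: t => //= j t; rewrite /reord /=.
case E: (onth s j) => [i|//] /=.
have ilt : i < size xs by apply: (allP sP); apply/onthP; exists j.
by rewrite onthE (nth_map x) //= => ->.
Qed.

Lemma reord_iota T (xs : seq T) : reord xs (iota 0 (size xs)) = xs.
Proof.
case: xs => // x xs; set ys := x :: xs.
rewrite -[RHS](mkseq_nth x) /mkseq /reord.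
have: all (gtn (size ys)) (iota 0 (size ys)).
  by apply/allP => i; rewrite mem_iota.
elim: (iota _ _) => //= i s IH /andP[ilt /IH ->].
by rewrite onthE (nth_map x).
Qed.

Lemma is_perm_lt n s : is_perm n s -> all (gtn n) s.
Proof.
by move=> /perm_mem sP; apply/allP => i; rewrite sP mem_iota.
Qed.

Lemma is_perm_size n s : is_perm n s -> size s = n.
Proof. by move=> /perm_size; rewrite size_iota. Qed.

Lemma size_reord_lt T (xs : seq T) s : all (gtn (size xs)) s ->
  size (reord xs s) = size s.
Proof.
move=> sP; rewrite /reord size_pmap (eq_count (a2 := gtn (size xs))).
  by move: sP; rewrite all_count => /eqP.
by move=> i /=; rewrite -onthTE.
Qed.

Lemma size_reord T (xs : seq T) s : is_perm (size xs) s ->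
  size (reord xs s) = size xs.
Proof.
by move=> sP; rewrite size_reord_lt ?is_perm_lt // (is_perm_size sP).
Qed.

Lemma perm_reord (T : eqType) (xs : seq T) s : is_perm (size xs) s ->
  perm_eq (reord xs s) xs.
Proof.
by move=> sP; rewrite -{2}[xs]reord_iota; apply: perm_pmap.
Qed.

Lemma is_perm_reord n s t : is_perm n s -> is_perm n t ->
  is_perm n (reord s t).
Proof.
move=> sP tP; have ? : is_perm (size s) t by rewrite (is_perm_size sP).
by apply: perm_trans (perm_reord _) sP.
Qed.

Lemma flatten_blocks ns : flatten (blocks ns) = iota 0 (sumn ns).
Proof. by rewrite reshapeKr // size_iota. Qed.

Lemma shape_blocks ns : shape (blocks ns) = ns.
Proof. by rewrite reshapeKl // size_iota. Qed.

Lemma size_blocks ns : size (blocks ns) = size ns.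
Proof. by rewrite size_reshape. Qed.

Lemma reord_blocks T (xss : seq (seq T)) :
  map (reord (flatten xss)) (blocks (shape xss)) = xss.
Proof.
have lt : all (all (gtn (size (flatten xss)))) (blocks (shape xss)).
  rewrite size_flatten -all_flatten flatten_blocks.
  by apply/allP => i; rewrite mem_iota.
rewrite -[RHS]flattenK -{2}[flatten xss]reord_iota size_flatten.
rewrite -flatten_blocks reord_flatten.
set ss := blocks _ in lt *.
have -> : shape xss = shape (map (reord (flatten xss)) ss).
  rewrite -[LHS]shape_blocks -/ss /shape -map_comp.
  elim: ss lt => //= s ss IH /andP[slt /IH->]; congr (_ :: _).
  by rewrite size_reord_lt.
by rewrite flattenK.
Qed.

Lemma reord_block_perm T (xss : seq (seq T)) s :
  reord (flatten xss) (block_perm (shape xss) s) = flatten (reord xss s).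
Proof. by rewrite reord_flatten -reord_map reord_blocks. Qed.

Lemma reord_perm_sum T (xss : seq (seq T)) ts :
  reord (flatten xss) (perm_sum (shape xss) ts) =
  flatten [seq reord p.1 p.2 | p <- zip xss ts].
Proof.
rewrite reord_flatten -map_comp -{3}[xss]reord_blocks; congr flatten.
have : all (all (gtn (size (flatten xss)))) (blocks (shape xss)).
  rewrite size_flatten -all_flatten flatten_blocks.
  by apply/allP => i; rewrite mem_iota.
elim: (blocks _) ts => [|b bs IH] [|t ts] //= /andP[blt /IH ->].
by rewrite reordM.
Qed.

Lemma is_perm_block ns s : is_perm (size ns) s ->
  is_perm (sumn ns) (block_perm ns s).
Proof.
move=> sP; rewrite /is_perm -flatten_blocks; apply: perm_flatten.
by apply: perm_reord; rewrite size_blocks.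
Qed.

Lemma is_perm_sum ns ts : all2 is_perm ns ts ->
  is_perm (sumn ns) (perm_sum ns ts).
Proof.
rewrite /is_perm -flatten_blocks /perm_sum -{1}(shape_blocks ns).
elim: (blocks ns) ts => [|b bs IH] [|t ts] //= /andP[tP /IH].
by apply: perm_cat; apply: perm_reord.
Qed.

End ReordTheory.

(* Operations f : (c_1, .., c_n) -> c are bundled into a single type, with
   [src f] = [:: c_1; ..; c_n] and [tgt f] = c.  The composite
   [ocomp f [:: g_1; ..; g_n]] is meaningful only if tgt g_i = c_i for all i,
   and [oact f s] only if s is a permutation of {0, .., n-1}; no law
   constrains their values otherwise. *)
Record preoperad : Type := Preoperad {
  col : Type;
  op : Type;
  src : op -> seq col;
  tgt : op -> col;
  oid : col -> op;
  ocomp : op -> seq op -> op;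
  oact : op -> seq nat -> op;
  src_oid : forall c, src (oid c) = [:: c];
  tgt_oid : forall c, tgt (oid c) = c;
  src_ocomp : forall f gs, map tgt gs = src f ->
    src (ocomp f gs) = flatten (map src gs);
  tgt_ocomp : forall f gs, map tgt gs = src f -> tgt (ocomp f gs) = tgt f;
  src_oact : forall f s, is_perm (size (src f)) s ->
    src (oact f s) = reord (src f) s;
  tgt_oact : forall f s, is_perm (size (src f)) s -> tgt (oact f s) = tgt f }.

Definition arity (P : preoperad) (f : op P) : nat := size (src f).

Definition composable (P : preoperad) (f : op P) (gs : seq (op P)) : Prop :=
  map (@tgt P) gs = src f.

(* The axioms of symmetric operads, up to a relation R. *)
Record operad_laws (P : preoperad) (R : op P -> op P -> Prop) : Prop :=
  OperadLaws {
  ocomp_idl : forall f, R (ocomp (oid (tgt f)) [:: f]) f;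
  ocomp_idr : forall f, R (ocomp f (map (@oid P) (src f))) f;
  ocompA : forall f gs hss, composable f gs ->
    map (map (@tgt P)) hss = map (@src P) gs ->
    R (ocomp (ocomp f gs) (flatten hss))
      (ocomp f [seq ocomp p.1 p.2 | p <- zip gs hss]);
  oact1 : forall f, R (oact f (iota 0 (arity f))) f;
  oactM : forall f s t, is_perm (arity f) s -> is_perm (arity f) t ->
    R (oact (oact f s) t) (oact f (reord s t));
  ocomp_actl : forall f gs s, composable f gs -> is_perm (arity f) s ->
    R (ocomp (oact f s) (reord gs s))
      (oact (ocomp f gs) (block_perm (map (@arity P) gs) s));
  ocomp_actr : forall f gs ts, composable f gs ->
    all2 is_perm (map (@arity P) gs) ts ->
    R (ocomp f [seq oact p.1 p.2 | p <- zip gs ts])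
      (oact (ocomp f gs) (perm_sum (map (@arity P) gs) ts)) }.

Section PreoperadTheory.
Variable P : preoperad.
Implicit Types (f g : op P) (gs : seq (op P)).

Lemma size_composable f gs : composable f gs -> size gs = arity f.
Proof. by rewrite /arity => <-; rewrite size_map. Qed.

Lemma map_arity gs : map (@arity P) gs = shape (map (@src P) gs).
Proof. by rewrite /shape -map_comp. Qed.

Lemma arity_comp f gs : composable f gs ->
  arity (ocomp f gs) = sumn (map (@arity P) gs).
Proof. by move=> fgs; rewrite /arity src_ocomp // size_flatten -map_arity. Qed.

Lemma arity_act f s : is_perm (arity f) s -> arity (oact f s) = arity f.
Proof. by move=> sP; rewrite /arity src_oact // size_reord. Qed.

Lemma composable_idl f : composable (oid (tgt f)) [:: f].
Proof. by rewrite /composable /= src_oid. Qed.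

Lemma composable_idr f : composable f (map (@oid P) (src f)).
Proof.
rewrite /composable -map_comp -[RHS]map_id.
by apply: eq_map => c /=; rewrite tgt_oid.
Qed.

Lemma composable_compl f gs hss : composable f gs ->
  map (map (@tgt P)) hss = map (@src P) gs ->
  composable (ocomp f gs) (flatten hss).
Proof.
by move=> fgs gshss; rewrite /composable src_ocomp // map_flatten gshss.
Qed.

Lemma composable_compr f gs hss : composable f gs ->
  map (map (@tgt P)) hss = map (@src P) gs ->
  composable f [seq ocomp p.1 p.2 | p <- zip gs hss].
Proof.
rewrite /composable => <-.
elim: gs hss => [|g gs IH] [|hs hss] //= [ghs /IH ->].
by rewrite tgt_ocomp.
Qed.

Lemma map_src_comp gs hss :
  map (map (@tgt P)) hss = map (@src P) gs ->
  map (@src P) [seq ocomp p.1 p.2 | p <- zip gs hss] =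
  map (fun hs => flatten (map (@src P) hs)) hss.
Proof.
elim: gs hss => [|g gs IH] [|hs hss] //= [ghs /IH ->].
by rewrite src_ocomp.
Qed.

Lemma composable_actl f gs s : composable f gs -> is_perm (arity f) s ->
  composable (oact f s) (reord gs s).
Proof.
by move=> fgs sP; rewrite /composable src_oact // -reord_map fgs.
Qed.

Lemma composable_actr f gs ts : composable f gs ->
  all2 is_perm (map (@arity P) gs) ts ->
  composable f [seq oact p.1 p.2 | p <- zip gs ts].
Proof.
rewrite /composable => <-.
elim: gs ts => [|g gs IH] [|t ts] //= /andP[tP /IH ->].
by rewrite tgt_oact.
Qed.

Lemma map_src_act gs ts : all2 is_perm (map (@arity P) gs) ts ->
  map (@src P) [seq oact p.1 p.2 | p <- zip gs ts] =
  [seq reord p.1 p.2 | p <- zip (map (@src P) gs) ts].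
Proof.
elim: gs ts => [|g gs IH] [|t ts] //= /andP[tP /IH ->].
by rewrite src_oact.
Qed.

Lemma is_perm_actl f gs s : composable f gs -> is_perm (arity f) s ->
  is_perm (arity (ocomp f gs)) (block_perm (map (@arity P) gs) s).
Proof.
move=> fgs sP; rewrite arity_comp //; apply: is_perm_block.
by rewrite size_map (size_composable fgs).
Qed.

Lemma is_perm_actr f gs ts : composable f gs ->
  all2 is_perm (map (@arity P) gs) ts ->
  is_perm (arity (ocomp f gs)) (perm_sum (map (@arity P) gs) ts).
Proof. by move=> fgs tsP; rewrite arity_comp //; apply: is_perm_sum. Qed.

Definition same_profile f g : Prop := src f = src g /\ tgt f = tgt g.

Lemma same_profile_laws : operad_laws same_profile.
Proof.
rewrite /same_profile.
split=> [f|f|f gs hss fgs gshss|f|f s t sP tP|f gs s fgs sP|f gs ts fgs tsP].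
- have fP := composable_idl f.
  by rewrite src_ocomp // tgt_ocomp // tgt_oid /= cats0.
- have fP := composable_idr f.
  rewrite src_ocomp // tgt_ocomp //; split=> //.
  rewrite -map_comp (eq_map (g := fun c => [:: c])) ?flatten_seq1 //.
  by move=> c /=; rewrite src_oid.
- have P1 := composable_compl fgs gshss; have P2 := composable_compr fgs gshss.
  rewrite (src_ocomp P1) (src_ocomp P2) (tgt_ocomp P1) (tgt_ocomp P2).
  rewrite (tgt_ocomp fgs) map_src_comp // map_flatten.
  by split=> //; elim: hss {gshss P1 P2} => //= hs hss; rewrite flatten_cat => ->.
- have iP : is_perm (size (src f)) (iota 0 (arity f)) by apply: perm_refl.
  by rewrite src_oact // tgt_oact // reord_iota.
- have stP := is_perm_reord sP tP.
  have tP' : is_perm (arity (oact f s)) t by rewrite arity_act.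
  rewrite (src_oact tP') (tgt_oact tP') (src_oact stP) (tgt_oact stP).
  by rewrite (src_oact sP) (tgt_oact sP) reordM // is_perm_lt.
- have P1 := composable_actl fgs sP; have P2 := is_perm_actl fgs sP.
  rewrite (src_ocomp P1) (tgt_ocomp P1) (src_oact P2) (tgt_oact P2).
  rewrite (tgt_oact sP) (src_ocomp fgs) (tgt_ocomp fgs).
  by rewrite map_arity reord_block_perm reord_map.
- have P1 := composable_actr fgs tsP; have P2 := is_perm_actr fgs tsP.
  rewrite (src_ocomp P1) (tgt_ocomp P1) (src_oact P2) (tgt_oact P2).
  by rewrite (src_ocomp fgs) (tgt_ocomp fgs) map_arity reord_perm_sum map_src_act.
Qed.

End PreoperadTheory.

Record operad : Type := Operad {
  preoperad_of :> preoperad;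
  operadP : operad_laws (P := preoperad_of) eq }.

Record operad_hom (P Q : operad) : Type := OperadHom {
  hcol : col P -> col Q;
  hop : op P -> op Q;
  hop_src : forall f, src (hop f) = map hcol (src f);
  hop_tgt : forall f, tgt (hop f) = hcol (tgt f);
  hop_id : forall c, hop (oid c) = oid (hcol c);
  hop_comp : forall f gs, composable f gs ->
    hop (ocomp f gs) = ocomp (hop f) (map hop gs);
  hop_act : forall f s, is_perm (arity f) s ->
    hop (oact f s) = oact (hop f) s }.

Lemma operad_hom_ext (P Q : operad) (h k : operad_hom P Q) :
  hcol h =1 hcol k -> hop h =1 hop k -> h = k.
Proof.
case: h k => [hc ho h1 h2 h3 h4 h5] [kc ko k1 k2 k3 k4 k5] /=.
move=> /funext hkc /funext hko; rewrite -{}hkc -{}hko in k1 k2 k3 k4 k5 *.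
by congr OperadHom; apply: Prop_irrelevance.
Qed.

Program Definition operad_idm (P : operad) : operad_hom P P :=
  @OperadHom P P id id _ _ _ _ _.
Next Obligation. by move=> * /=; rewrite map_id. Qed.
Next Obligation. by []. Qed.
Next Obligation. by []. Qed.
Next Obligation. by move=> * /=; rewrite map_id. Qed.
Next Obligation. by []. Qed.

Lemma hop_composable (P Q : operad) (h : operad_hom P Q) f gs :
  composable f gs -> composable (hop h f) (map (hop h) gs).
Proof.
rewrite /composable hop_src => <-; rewrite -!map_comp.
by apply: eq_map => g /=; rewrite hop_tgt.
Qed.

Lemma hop_arity (P Q : operad) (h : operad_hom P Q) f :
  arity (hop h f) = arity f.
Proof. by rewrite /arity hop_src size_map. Qed.

Program Definition operad_cmp (P Q R : operad)
    (k : operad_hom Q R) (h : operad_hom P Q) : operad_hom P R :=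
  @OperadHom P R (hcol k \o hcol h) (hop k \o hop h) _ _ _ _ _.
Next Obligation. by move=> * /=; rewrite !hop_src map_comp. Qed.
Next Obligation. by move=> * /=; rewrite !hop_tgt. Qed.
Next Obligation. by move=> * /=; rewrite !hop_id. Qed.
Next Obligation.
move=> P Q R k h f gs fgs /=.
by rewrite (hop_comp h fgs) (hop_comp k (hop_composable h fgs)) map_comp.
Qed.
Next Obligation.
by move=> P Q R k h f s sP /=; rewrite (hop_act h sP) hop_act ?hop_arity.
Qed.

Program Definition Op : category :=
  @Category operad operad_hom operad_idm operad_cmp _ _ _.
Next Obligation. by move=> *; apply: operad_hom_ext. Qed.
Next Obligation. by move=> *; apply: operad_hom_ext. Qed.
Next Obligation. by move=> *; apply: operad_hom_ext. Qed.

Record congruence (P : preoperad) (R : op P -> op P -> Prop) : Prop :=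
  Congruence {
  cong_refl : forall f, R f f;
  cong_sym : forall f g, R f g -> R g f;
  cong_trans : forall f g h, R f g -> R g h -> R f h;
  cong_src : forall f g, R f g -> src f = src g;
  cong_tgt : forall f g, R f g -> tgt f = tgt g;
  cong_comp : forall f f' gs gs', composable f gs ->
    R f f' -> List.Forall2 R gs gs' -> R (ocomp f gs) (ocomp f' gs');
  cong_act : forall f f' s, is_perm (arity f) s ->
    R f f' -> R (oact f s) (oact f' s);
  cong_laws : operad_laws R }.

Section Quotient.
Variables (P : preoperad) (R : op P -> op P -> Prop).
Hypothesis RP : congruence R.

Definition cong_rel : rel {classic op P} := fun f g => `[< R f g >].

Lemma cong_rel_equiv : equiv_class_of cong_rel.
Proof.
split=> [f|f g|g f h] /=.
- by apply/asboolP; apply: cong_refl.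
- by apply/asboolP/asboolP; apply: cong_sym.
- by move=> /asboolP Rfg /asboolP Rgh; apply/asboolP; apply: cong_trans Rgh.
Qed.

Definition cong_equiv : equiv_rel {classic op P} :=
  EquivRelPack cong_rel_equiv.

Definition qop : Type := {eq_quot cong_equiv}%qT.
Definition qpi (f : op P) : qop := (\pi_({eq_quot cong_equiv}%qT) f)%qT.
Definition qrepr (F : qop) : op P := repr (F : {eq_quot cong_equiv}%qT).

Lemma qreprK F : qpi (qrepr F) = F.
Proof. exact: reprK. Qed.

Lemma qpiP f g : qpi f = qpi g <-> R f g.
Proof.
split=> [/eqmodP/asboolP //|Rfg].
by apply/eqmodP; apply/asboolP.
Qed.

Lemma qrepr_pi f : R (qrepr (qpi f)) f.
Proof. by apply/qpiP; rewrite qreprK. Qed.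

Lemma map_qreprK Fs : map qpi (map qrepr Fs) = Fs.
Proof. by rewrite -map_comp -[RHS]map_id; apply: eq_map => F; rewrite /= qreprK. Qed.

Definition qsrc F := src (qrepr F).
Definition qtgt F := tgt (qrepr F).
Definition qid c := qpi (oid c).
Definition qcomp F Gs := qpi (ocomp (qrepr F) (map qrepr Gs)).
Definition qact F s := qpi (oact (qrepr F) s).

Lemma qsrc_pi f : qsrc (qpi f) = src f.
Proof. by rewrite /qsrc (cong_src RP (qrepr_pi f)). Qed.

Lemma qtgt_pi f : qtgt (qpi f) = tgt f.
Proof. by rewrite /qtgt (cong_tgt RP (qrepr_pi f)). Qed.

Lemma map_qtgt Gs : map qtgt Gs = map (@tgt P) (map qrepr Gs).
Proof. by rewrite -map_comp. Qed.

Lemma map_qsrc Gs : map qsrc Gs = map (@src P) (map qrepr Gs).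
Proof. by rewrite -map_comp. Qed.

Program Definition quot_preoperad : preoperad :=
  @Preoperad (col P) qop qsrc qtgt qid qcomp qact _ _ _ _ _ _.
Next Obligation. by move=> c; rewrite qsrc_pi src_oid. Qed.
Next Obligation. by move=> c; rewrite qtgt_pi tgt_oid. Qed.
Next Obligation.
move=> F Gs; rewrite map_qtgt map_qsrc => FGs.
by rewrite qsrc_pi src_ocomp.
Qed.
Next Obligation.
by move=> F Gs; rewrite map_qtgt => FGs; rewrite qtgt_pi tgt_ocomp.
Qed.
Next Obligation. by move=> F s sP; rewrite qsrc_pi src_oact. Qed.
Next Obligation. by move=> F s sP; rewrite qtgt_pi tgt_oact. Qed.

Lemma qcompE f gs : composable f gs ->
  qcomp (qpi f) (map qpi gs) = qpi (ocomp f gs).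
Proof.
move=> fgs; apply/esym/qpiP; apply: cong_comp => //.
  exact: cong_sym (qrepr_pi f).
elim: gs {fgs} => [|g gs IH] /=; constructor=> //.
exact: cong_sym (qrepr_pi g).
Qed.

Lemma qactE f s : is_perm (arity f) s -> qact (qpi f) s = qpi (oact f s).
Proof.
by move=> sP; apply/esym/qpiP; apply: cong_act => //; apply: cong_sym (qrepr_pi f).
Qed.

Lemma map_qtgt_pi gs : map qtgt (map qpi gs) = map (@tgt P) gs.
Proof. by rewrite -map_comp; apply: eq_map => g /=; rewrite qtgt_pi. Qed.

Lemma map_qsrc_pi gs : map qsrc (map qpi gs) = map (@src P) gs.
Proof. by rewrite -map_comp; apply: eq_map => g /=; rewrite qsrc_pi. Qed.

Lemma qarity_pi f : @arity quot_preoperad (qpi f) = arity f.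
Proof. by rewrite /arity /= qsrc_pi. Qed.

Lemma map_qarity_pi gs :
  map (@arity quot_preoperad) (map qpi gs) = map (@arity P) gs.
Proof. by rewrite -map_comp; apply: eq_map => g; apply: qarity_pi. Qed.

Lemma qcomposable_pi f gs :
  @composable quot_preoperad (qpi f) (map qpi gs) <-> composable f gs.
Proof. by rewrite /composable /= qsrc_pi map_qtgt_pi. Qed.

Lemma quot_operad_laws : operad_laws (P := quot_preoperad) eq.
Proof.
have laws := cong_laws RP.
have piE F : exists f, F = qpi f by exists (qrepr F); rewrite qreprK.
have mpiE Gs : exists gs, Gs = map qpi gs.
  by exists (map qrepr Gs); rewrite map_qreprK.
have mmpiE Hss : exists hss, Hss = map (map qpi) hss.
  exists (map (map qrepr) Hss); rewrite -map_comp -[LHS]map_id.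
  by apply: eq_map => Hs /=; rewrite map_qreprK.
split=> /= [F|F|F Gs Hss|F|F s t|F Gs s|F Gs ts]; have [f ->] := piE F;
  rewrite /= ?qarity_pi ?qsrc_pi ?qtgt_pi.
- rewrite (@qcompE _ [:: f] (composable_idl _)).
  by apply/qpiP; apply: ocomp_idl.
- have -> : map qid (src f) = map qpi (map (@oid P) (src f)).
    by rewrite -map_comp.
  rewrite (qcompE (composable_idr _)).
  by apply/qpiP; apply: ocomp_idr.
- have [gs ->] := mpiE Gs; have [hss ->] := mmpiE Hss.
  move=> /qcomposable_pi fgs; rewrite map_qsrc_pi -map_comp.
  rewrite (eq_map (g := map (@tgt P))); last by move=> hs; apply: map_qtgt_pi.
  move=> gshss; rewrite (qcompE fgs) -map_flatten.
  rewrite (qcompE (composable_compl fgs gshss)).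
  have -> : [seq qcomp p.1 p.2 | p <- zip (map qpi gs) (map (map qpi) hss)] =
            map qpi [seq ocomp p.1 p.2 | p <- zip gs hss].
    elim: gs hss gshss {fgs} => [|g gs IH] [|hs hss] //= [ghs /IH ->].
    by rewrite qcompE.
  rewrite (qcompE (composable_compr fgs gshss)).
  by apply/qpiP; apply: ocompA.
- by rewrite qactE; [apply/qpiP; apply: oact1|apply: perm_refl].
- move=> sP tP; rewrite !qactE ?arity_act ?is_perm_reord //.
  by apply/qpiP; apply: oactM.
- have [gs ->] := mpiE Gs; move=> /qcomposable_pi fgs sP.
  rewrite map_qarity_pi reord_map qactE // !qcompE //; last exact: composable_actl.
  rewrite qactE; last exact: is_perm_actl.
  by apply/qpiP; apply: ocomp_actl.
- have [gs ->] := mpiE Gs; move=> /qcomposable_pi fgs.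
  rewrite map_qarity_pi => tsP; rewrite (qcompE fgs).
  rewrite qactE; last exact: is_perm_actr.
  have -> : [seq qact p.1 p.2 | p <- zip (map qpi gs) ts] =
            map qpi [seq oact p.1 p.2 | p <- zip gs ts].
    elim: gs ts tsP {fgs} => [|g gs IH] [|t ts] //= /andP[tP /IH ->].
    by rewrite qactE.
  rewrite (qcompE (composable_actr fgs tsP)).
  by apply/qpiP; apply: ocomp_actr.
Qed.

Definition quot_operad : operad := Operad quot_operad_laws.

End Quotient.

(* A symmetric collection with colours C: generators with a profile, on which
   the symmetric groups act. *)
Record collection (C : Type) : Type := Collection {
  gen : Type;
  gsrc : gen -> seq C;
  gtgt : gen -> C;
  gact : gen -> seq nat -> gen;
  gsrc_act : forall g s, is_perm (size (gsrc g)) s ->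
    gsrc (gact g s) = reord (gsrc g) s;
  gtgt_act : forall g s, is_perm (size (gsrc g)) s ->
    gtgt (gact g s) = gtgt g;
  gact1 : forall g, gact g (iota 0 (size (gsrc g))) = g;
  gactM : forall g s t,
    is_perm (size (gsrc g)) s -> is_perm (size (gsrc g)) t ->
    gact (gact g s) t = gact g (reord s t) }.

Section Free.
Variables (C : Type) (X : collection C).

Inductive term : Type :=
| TId of C
| TGen of gen X
| TComp of term & seq term
| TAct of term & seq nat.

Fixpoint tsrc (t : term) : seq C :=
  match t with
  | TId c => [:: c]
  | TGen g => gsrc g
  | TComp _ gs => flatten (map tsrc gs)
  | TAct f s => reord (tsrc f) s
  end.

Fixpoint ttgt (t : term) : C :=
  match t with
  | TId c => c
  | TGen g => gtgt g
  | TComp f _ => ttgt f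
  | TAct f _ => ttgt f
  end.

Fixpoint wf (t : term) : Prop :=
  match t with
  | TId _ | TGen _ => True
  | TComp f gs =>
      [/\ wf f, foldr (fun g Q => wf g /\ Q) True gs & map ttgt gs = tsrc f]
  | TAct f s => wf f /\ is_perm (size (tsrc f)) s
  end.

Definition wterm : Type := {t : term | wf t}.

Definition wsrc (f : wterm) : seq C := tsrc (sval f).
Definition wtgt (f : wterm) : C := ttgt (sval f).
Definition wid (c : C) : wterm := exist wf (TId c) I.
Definition wgen (g : gen X) : wterm := exist wf (TGen g) I.

Lemma wf_all (gs : seq wterm) :
  foldr (fun g Q => wf g /\ Q) True (map sval gs).
Proof. by elim: gs => //= g gs; split=> //; apply: svalP. Qed.

Lemma wf_comp (f : wterm) (gs : seq wterm) :
  map wtgt gs = wsrc f -> wf (TComp (sval f) (map sval gs)).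
Proof.
by move=> fgs /=; split; [apply: svalP|apply: wf_all|rewrite -map_comp].
Qed.

Lemma wf_act (f : wterm) (s : seq nat) :
  is_perm (size (wsrc f)) s -> wf (TAct (sval f) s).
Proof. by move=> sP; split=> //; apply: svalP. Qed.

Definition wcomp (f : wterm) (gs : seq wterm) : wterm :=
  match pselect (map wtgt gs = wsrc f) with
  | left fgs => exist wf _ (wf_comp fgs)
  | right _ => f
  end.

Definition wact (f : wterm) (s : seq nat) : wterm :=
  match pselect (is_perm (size (wsrc f)) s) with
  | left sP => exist wf _ (wf_act sP)
  | right _ => f
  end.

Program Definition terms : preoperad :=
  @Preoperad C wterm wsrc wtgt wid wcomp wact _ _ _ _ _ _.
Next Obligation. by []. Qed.
Next Obligation. by []. Qed.
Next Obligation.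
by move=> f gs fgs; rewrite /wcomp; case: pselect => //= ?;
   rewrite /wsrc /= -map_comp.
Qed.
Next Obligation. by move=> f gs fgs; rewrite /wcomp; case: pselect. Qed.
Next Obligation. by move=> f s sP; rewrite /wact; case: pselect. Qed.
Next Obligation. by move=> f s sP; rewrite /wact; case: pselect. Qed.

Definition respects_gact (R : wterm -> wterm -> Prop) : Prop :=
  forall g s, is_perm (size (gsrc g)) s -> R (wact (wgen g) s) (wgen (gact g s)).

(* The least congruence on well-formed formal composites that identifies the
   formal action of a permutation on a generator with its given action. *)
Definition free_rel (f g : wterm) : Prop :=
  forall R, congruence (P := terms) R -> respects_gact R -> R f g.

Lemma same_profile_congruence (P : preoperad) :
  congruence (@same_profile P).
Proof.
have src2 gs gs' : List.Forall2 (@same_profile P) gs gs' ->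
    map (@src P) gs = map (@src P) gs' /\ map (@tgt P) gs = map (@tgt P) gs'.
  by elim=> //= {gs gs'} g g' gs gs' [-> ->] _ [-> ->].
rewrite /same_profile; split.
- by [].
- by move=> f g [-> ->].
- by move=> f g h [-> ->].
- by move=> f g [].
- by move=> f g [].
- move=> f f' gs gs' fgs [fs ft] /src2[gss gst].
  have fgs' : composable f' gs' by rewrite /composable -gst -fs.
  by rewrite (src_ocomp fgs) (src_ocomp fgs') (tgt_ocomp fgs) (tgt_ocomp fgs')
             gss ft.
- move=> f f' s sP [fs ft].
  have sP' : is_perm (arity f') s by rewrite /arity -fs.
  by rewrite (src_oact sP) (src_oact sP') (tgt_oact sP) (tgt_oact sP') fs ft.
- exact: same_profile_laws.
Qed.

Lemma free_rel_profile f g : free_rel f g -> @same_profile terms f g.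
Proof.
apply; first exact: same_profile_congruence.
move=> {}g s sP; rewrite /same_profile (@src_oact terms) // (@tgt_oact terms) //.
by rewrite /= /wsrc /wtgt /= gsrc_act // gtgt_act.
Qed.

Lemma free_rel_congruence : congruence (P := terms) free_rel.
Proof.
split.
- by move=> f R RP _; apply: (cong_refl RP).
- by move=> f g fg R RP RX; apply: (cong_sym RP); apply: fg.
- move=> f g h fg gh R RP RX.
  by apply: (cong_trans RP (fg R RP RX)); apply: gh.
- by move=> f g /free_rel_profile[].
- by move=> f g /free_rel_profile[].
- move=> f f' gs gs' fgs ff' gg' R RP RX; apply: (cong_comp RP fgs).
    exact: ff'.
  by elim: gg' => [|g g' l l' gg' _]; constructor=> //; apply: gg'.
- move=> f f' s sP ff' R RP RX; apply: (cong_act RP sP); exact: ff'.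
- split=> [f|f|f gs hss fgs gshss|f|f s t sP tP|f gs s fgs sP|f gs ts fgs tsP]
    R RP RX; have laws := cong_laws RP.
  + exact: (ocomp_idl laws).
  + exact: (ocomp_idr laws).
  + exact: (ocompA laws).
  + exact: (oact1 laws).
  + exact: (oactM laws).
  + exact: (ocomp_actl laws).
  + exact: (ocomp_actr laws).
Qed.

Definition free_operad : operad := quot_operad free_rel_congruence.

Definition free_gen (g : gen X) : op free_operad :=
  qpi free_rel_congruence (wgen g).

Lemma free_gen_src g : src (free_gen g) = gsrc g.
Proof. exact: (@qsrc_pi terms _ free_rel_congruence (wgen g)). Qed.

Lemma free_gen_tgt g : tgt (free_gen g) = gtgt g.
Proof. exact: (@qtgt_pi terms _ free_rel_congruence (wgen g)). Qed.

Lemma free_gen_act g s : is_perm (size (gsrc g)) s ->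
  oact (free_gen g) s = free_gen (gact g s).
Proof.
move=> sP.
rewrite /free_gen [LHS](@qactE terms _ free_rel_congruence (wgen g) s sP).
by apply/qpiP => R RP RX; apply: RX.
Qed.

Section Universal.
Variables (P : operad) (h : C -> col P) (k : gen X -> op P).
Hypothesis k_src : forall g, src (k g) = map h (gsrc g).
Hypothesis k_tgt : forall g, tgt (k g) = h (gtgt g).
Hypothesis k_act : forall g s, is_perm (size (gsrc g)) s ->
  k (gact g s) = oact (k g) s.

Fixpoint teval (t : term) : op P :=
  match t with
  | TId c => oid (h c)
  | TGen g => k g
  | TComp f gs => ocomp (teval f) (map teval gs)
  | TAct f s => oact (teval f) s
  end.

Lemma teval_profile t : wf t ->
  src (teval t) = map h (tsrc t) /\ tgt (teval t) = h (ttgt t).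
Proof.
move: t; fix IH 1 => -[c|g|f gs|f s] /=.
- by rewrite src_oid tgt_oid.
- by rewrite k_src k_tgt.
- move=> [/IH[fs ft] wgs fgs].
  have [gss gst] : map (@src P) (map teval gs) = map (map h) (map tsrc gs) /\
                   map (@tgt P) (map teval gs) = map h (map ttgt gs).
    elim: gs wgs {fgs} => //= g gs IHgs [/IH[-> ->] /IHgs[-> ->]].
    by [].
  have c : composable (teval f) (map teval gs).
    by rewrite /composable gst fs fgs.
  by rewrite (src_ocomp c) (tgt_ocomp c) gss ft map_flatten.
- move=> [/IH[fs ft] sP].
  have sP' : is_perm (size (src (teval f))) s by rewrite fs size_map.
  by rewrite (src_oact sP') (tgt_oact sP') fs ft reord_map.
Qed.

Definition weval (f : op terms) : op P := teval (sval f).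

Lemma weval_src f : src (weval f) = map h (src f).
Proof. by case: (teval_profile (svalP f)). Qed.

Lemma weval_tgt f : tgt (weval f) = h (tgt f).
Proof. by case: (teval_profile (svalP f)). Qed.

Lemma weval_arity f : arity (weval f) = arity f.
Proof. by rewrite /arity weval_src size_map. Qed.

Lemma weval_composable f gs : composable f gs ->
  composable (weval f) (map weval gs).
Proof.
rewrite /composable weval_src => <-; rewrite -!map_comp.
by apply: eq_map => g /=; rewrite weval_tgt.
Qed.

Lemma weval_comp f gs : composable f gs ->
  weval (ocomp f gs) = ocomp (weval f) (map weval gs).
Proof.
move=> fgs; rewrite /weval /= /wcomp; case: pselect => //= _.
by rewrite -map_comp.
Qed.

Lemma weval_act f s : is_perm (arity f) s ->
  weval (oact f s) = oact (weval f) s.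
Proof. by move=> sP; rewrite /weval /= /wact; case: pselect. Qed.

Definition weval_rel (f g : op terms) : Prop :=
  same_profile f g /\ weval f = weval g.

Lemma weval_congruence : congruence weval_rel.
Proof.
have SP := same_profile_congruence terms.
have PP := operadP P.
split.
- by move=> f; split=> //; apply: (cong_refl SP).
- by move=> f g [fg fgE]; split=> //; apply: (cong_sym SP).
- move=> f g l [fg fgE] [gl glE]; split; last by rewrite fgE.
  exact: (cong_trans SP fg gl).
- by move=> f g [[]].
- by move=> f g [[]].
- move=> f f' gs gs' fgs [ff' ffE] gg'.
  have [gg1 gg2] : List.Forall2 (@same_profile terms) gs gs' /\
                   map weval gs = map weval gs'.
    elim: gg' => [|g g' l l' [gg' E] _ [IH1 IH2]]; first by split.
    by split; [constructor|rewrite /= E IH2].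
  have SPc := cong_comp SP fgs ff' gg1; split=> //.
  have fgs' : composable f' gs'.
    rewrite /composable -ff'.1 -fgs.
    by elim: gg1 => //= g g' l l' [_ E] _ ->; congr cons; apply: esym.
  by rewrite weval_comp // weval_comp // ffE gg2.
- move=> f f' s sP [ff' ffE]; have SPa := cong_act SP sP ff'; split=> //.
  have sP' : is_perm (arity f') s by rewrite /arity -ff'.1.
  by rewrite !weval_act // ffE.
have SL := cong_laws SP.
split=> [f|f|f gs hss fgs gshss|f|f s t sP tP|f gs s fgs sP|f gs ts fgs tsP].
- split; first exact: (ocomp_idl SL).
  rewrite (weval_comp (composable_idl f)) -[RHS](ocomp_idl PP) weval_tgt.
  by [].
- split; first exact: (ocomp_idr SL).
  rewrite (weval_comp (composable_idr f)) -[RHS](ocomp_idr PP) weval_src.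
  by rewrite -!map_comp.
- split; first exact: (ocompA SL).
  rewrite (weval_comp (composable_compl fgs gshss)) (weval_comp fgs).
  rewrite (weval_comp (composable_compr fgs gshss)) map_flatten.
  rewrite (ocompA PP (weval_composable fgs)); last first.
    rewrite -!map_comp (eq_map (g := map h \o @src terms)); last first.
      by move=> g /=; rewrite weval_src.
    rewrite [RHS]map_comp -gshss -map_comp; apply: eq_map => hs /=.
    by rewrite -!map_comp; apply: eq_map => g /=; rewrite weval_tgt.
  congr ocomp; elim: gs hss gshss {fgs} => [|g gs IH] [|hs hss] //= [ghs /IH ->].
  by rewrite weval_comp.
- split; first exact: (oact1 SL).
  have iP : is_perm (arity f) (iota 0 (arity f)) by apply: perm_refl.
  by rewrite weval_act // -[X in iota 0 X]weval_arity (oact1 PP).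
- split; first exact: (oactM SL).
  have stP := is_perm_reord sP tP.
  rewrite weval_act ?arity_act // !weval_act //.
  by rewrite (oactM PP) ?weval_arity.
- split; first exact: (ocomp_actl SL).
  have E : map (@arity terms) gs = map (@arity P) (map weval gs).
    by rewrite -map_comp; apply: eq_map => g; rewrite /= weval_arity.
  rewrite (weval_comp (composable_actl fgs sP)) (weval_act (is_perm_actl fgs sP)).
  rewrite weval_act // (weval_comp fgs) -reord_map E.
  by rewrite (ocomp_actl PP (weval_composable fgs)) ?weval_arity.
- split; first exact: (ocomp_actr SL).
  have E : map (@arity terms) gs = map (@arity P) (map weval gs).
    by rewrite -map_comp; apply: eq_map => g; rewrite /= weval_arity.
  rewrite (weval_comp (composable_actr fgs tsP)) (weval_act (is_perm_actr fgs tsP)).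
  rewrite (weval_comp fgs) E -(ocomp_actr PP (weval_composable fgs)) -?E //.
  congr ocomp; elim: gs ts tsP {fgs E} => [|g gs IH] [|t ts] //= /andP[tP /IH ->].
  by rewrite weval_act.
Qed.

Lemma free_rel_weval f g : free_rel f g -> weval f = weval g.
Proof.
move=> fg; suff [] : weval_rel f g by [].
apply: fg; first exact: weval_congruence.
move=> {}g s sP; split.
  rewrite /same_profile (@src_oact terms) // (@tgt_oact terms) //.
  by rewrite /= /wsrc /wtgt /= gsrc_act // gtgt_act.
by rewrite (@weval_act (wgen g)) // /weval /= k_act.
Qed.

Definition free_eval (F : op free_operad) : op P := weval (qrepr F).

Lemma free_eval_pi f : free_eval (qpi free_rel_congruence f) = weval f.
Proof. exact: (free_rel_weval (qrepr_pi free_rel_congruence f)). Qed.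

Program Definition free_ext : operad_hom free_operad P :=
  @OperadHom free_operad P h free_eval _ _ _ _ _.
Next Obligation. by move=> F; apply: (weval_src (qrepr F)). Qed.
Next Obligation. by move=> F; apply: (weval_tgt (qrepr F)). Qed.
Next Obligation. by move=> c; apply: (free_eval_pi (wid c)). Qed.
Next Obligation.
move=> F Gs FGs.
have FGs' : @composable terms (qrepr F) (map (@qrepr terms _ free_rel_congruence) Gs).
  by rewrite /composable -[RHS]FGs -map_comp.
apply: etrans (free_eval_pi _) _; apply: etrans (weval_comp FGs') _.
by congr ocomp; rewrite -map_comp.
Qed.
Next Obligation.
move=> F s sP; apply: etrans (free_eval_pi _) _.
exact: (@weval_act (qrepr F) s sP).
Qed.

(* [free_ext_gen] and [free_ext_unique]: the universal property of the free
   symmetric operad on X. *)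
Lemma free_ext_gen g : hop free_ext (free_gen g) = k g.
Proof. exact: free_eval_pi. Qed.

Lemma free_ext_unique (phi : operad_hom free_operad P) :
  hcol phi =1 h -> (forall g, hop phi (free_gen g) = k g) -> phi = free_ext.
Proof.
move=> phiC phiG; apply: operad_hom_ext => // F.
rewrite -(qreprK F) [RHS]free_eval_pi; case: (qrepr F) => t; rewrite /weval /=.
move: t; fix IH 1 => -[c|g|f gs|f s] tP.
- have -> : exist wf (TId c) tP = wid c by congr exist; apply: Prop_irrelevance.
  by rewrite [LHS](hop_id phi c) phiC.
- have -> : exist wf (TGen g) tP = wgen g by congr exist; apply: Prop_irrelevance.
  exact: phiG.
- have [fP gsP fgs] := tP.
  have [ws wsE wsP] : exists2 ws : seq wterm, gs = map sval ws &
      forall w, List.In w ws -> hop phi (qpi free_rel_congruence w) = teval (sval w).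
    elim: gs gsP {tP fgs} => [|g gs IHgs] /=; first by exists [::].
    move=> [gP /IHgs[ws -> wsP]]; exists (exist wf g gP :: ws) => //.
    by move=> w /= [<-|/wsP//]; apply: IH.
  have c : @composable terms (exist wf f fP) ws.
    by rewrite /composable -[RHS]fgs wsE -map_comp.
  have -> : exist wf (TComp f gs) tP = wcomp (exist wf f fP) ws.
    rewrite /wcomp; case: pselect => // c'.
    apply: eq_exist; by rewrite wsE.
  rewrite -[qpi _ _](@qcompE terms _ free_rel_congruence _ _ c).
  rewrite [LHS](hop_comp phi); last by apply/qcomposable_pi.
  rewrite [hop phi _]IH /= wsE; congr ocomp; rewrite -!map_comp.
  elim: ws wsP {wsE c} => //= w ws IHws wsP; congr cons.
    by apply: wsP; left.
  by apply: IHws => w' w'P; apply: wsP; right.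
- have [fP sP] := tP.
  have -> : exist wf (TAct f s) tP = wact (exist wf f fP) s.
    by rewrite /wact; case: pselect => // sP'; apply: eq_exist.
  rewrite -[qpi _ _](@qactE terms _ free_rel_congruence (exist wf f fP) s sP).
  rewrite [LHS](hop_act phi); last first.
    by rewrite (@qarity_pi terms _ free_rel_congruence).
  by rewrite [hop phi _]IH.
Qed.

End Universal.

End Free.

(* Combinatorial trees are finite simple graphs on a vertex set V: a cycle
   visits at least three distinct vertices. *)
Record tree (V : finType) : Type := Tree {
  adj : rel V;
  out : V;
  ins : {set V};
  adj_sym : symmetric adj;
  adj_irr : irreflexive adj;
  adj_connected : forall v w, connect adj v w;
  adj_acyclic : forall c : seq V, ucycle adj c -> size c <= 2;
  out_outer : #|[set w | adj out w]| = 1;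
  ins_outer : forall v, v \in ins -> #|[set w | adj v w]| = 1;
  out_notin : out \notin ins }.

Section Tree.
Variables (V : finType) (T : tree V).

Definition is_edge (e : {set V}) : bool :=
  [exists v, exists w, adj T v w && (e == [set v; w])].

Definition edge : Type := {e : {set V} | is_edge e}.

Definition is_vertex (v : V) : bool := (v != out T) && (v \notin ins T).

(* The edge {v, w} is oriented from v to w when the simple path from v to the
   output starts with w. *)
Definition oriented (v w : V) : Prop :=
  exists p : seq V,
    [/\ path (adj T) v (w :: p), uniq (v :: w :: p) & last w p = out T].

Definition output_edge (v : V) (e : edge) : Prop :=
  exists w, oriented v w /\ val e = [set v; w].

Definition input_edge (v : V) (e : edge) : Prop :=
  exists w, oriented w v /\ val e = [set w; v].

(* A vertex together with an ordering of its input edges. *)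
Record tgen : Type := TGenerator {
  tgen_vertex : V;
  tgen_ins : seq edge;
  tgen_out : edge;
  tgen_vertexP : is_vertex tgen_vertex;
  tgen_outP : output_edge tgen_vertex tgen_out;
  tgen_uniq : uniq tgen_ins;
  tgen_insP : forall e, e \in tgen_ins <-> input_edge tgen_vertex e }.

Lemma tgen_ext (g h : tgen) : tgen_vertex g = tgen_vertex h ->
  tgen_ins g = tgen_ins h -> tgen_out g = tgen_out h -> g = h.
Proof.
case: g h => [v s e p1 p2 p3 p4] [w t d q1 q2 q3 q4] /= vw st ed.
case: _ / vw in q1 q2 q4 *; case: _ / st in q3 q4 *; case: _ / ed in q2 *.
by congr TGenerator; apply: Prop_irrelevance.
Qed.

Definition permute_ins (s : seq edge) (p : seq nat) : seq edge :=
  if is_perm (size s) p then reord s p else s.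

Lemma perm_permute_ins s p : perm_eq (permute_ins s p) s.
Proof. by rewrite /permute_ins; case: ifP => // sP; apply: perm_reord. Qed.

Program Definition tgen_act (g : tgen) (p : seq nat) : tgen :=
  @TGenerator (tgen_vertex g) (permute_ins (tgen_ins g) p) (tgen_out g) _ _ _ _.
Next Obligation. by move=> g _; apply: tgen_vertexP. Qed.
Next Obligation. by move=> g _; apply: tgen_outP. Qed.
Next Obligation.
by move=> g p; rewrite (perm_uniq (perm_permute_ins _ _)); apply: tgen_uniq.
Qed.
Next Obligation.
by move=> g p e; rewrite (perm_mem (perm_permute_ins _ _)); apply: tgen_insP.
Qed.

Program Definition tree_collection : collection edge :=
  @Collection edge tgen tgen_ins tgen_out tgen_act _ _ _ _.
Next Obligation. by move=> g p pP /=; rewrite /permute_ins pP. Qed.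
Next Obligation. by []. Qed.
Next Obligation.
move=> g; apply: tgen_ext => //=.
by rewrite /permute_ins /is_perm perm_refl reord_iota.
Qed.
Next Obligation.
move=> g p q pP qP; apply: tgen_ext => //=.
rewrite {2}/permute_ins pP /permute_ins size_reord // qP is_perm_reord //.
by rewrite reordM // is_perm_lt.
Qed.

Definition tree_operad : operad := free_operad tree_collection.

End Tree.

(* Every finite tree can be renamed to have vertex set 'I_n. *)
Definition ord_tree : Type := {n : nat & tree 'I_n}.

Definition tree_iso (S T : ord_tree) : Prop :=
  exists f : 'I_(tag S) -> 'I_(tag T),
    [/\ bijective f,
        forall v w, adj (tagged T) (f v) (f w) = adj (tagged S) v w,
        f (out (tagged S)) = out (tagged T) &
        forall v, (f v \in ins (tagged T)) = (v \in ins (tagged S))].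

Definition tree_iso_rel : rel {classic ord_tree} :=
  fun S T => `[< tree_iso S T >].

Lemma tree_iso_equiv : equiv_class_of tree_iso_rel.
Proof.
split=> [S|S T|U S T] /=.
- by apply/asboolP; exists id; split=> //; exists id.
- have sym (S' T' : ord_tree) : tree_iso S' T' -> tree_iso T' S'.
    case=> f [[g fK gK] fadj fout fins]; exists g; split.
    + by exists f.
    + by move=> v w; rewrite -fadj !gK.
    + by rewrite -fout fK.
    + by move=> v; rewrite -fins gK.
  by apply/asboolP/asboolP; apply: sym.
- move=> /asboolP[f [fbij fadj fout fins]] /asboolP[g [gbij gadj gout gins]].
  apply/asboolP; exists (g \o f); split=> [|v w||v] /=.
  + exact: bij_comp.
  + by rewrite gadj fadj.
  + by rewrite fout gout.
  + by rewrite gins fins.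
Qed.

Definition tree_iso_equiv_rel : equiv_rel {classic ord_tree} :=
  EquivRelPack tree_iso_equiv.

(* Isomorphism classes of trees; morphisms are computed on a chosen
   representative of each class, so that Omega is skeletal. *)
Definition tree_class : Type := {eq_quot tree_iso_equiv_rel}%qT.

Definition tree_repr (c : tree_class) : ord_tree :=
  repr (c : {eq_quot tree_iso_equiv_rel}%qT).

Definition Omega_operad (c : tree_class) : Op :=
  tree_operad (tagged (tree_repr c)).

Definition Omega : category :=
  @Category tree_class
    (fun S T => @hom Op (Omega_operad S) (Omega_operad T))
    (fun S => idm (Omega_operad S)) (fun _ _ _ g f => g \oc f)
    (fun _ _ f => cmp1m f) (fun _ _ f => cmpm1 f)
    (fun _ _ _ _ h g f => cmpA h g f).

(* Main.v *)
Require Import Defs.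
From HB Require Import structures.
From Stdlib Require List.
From mathcomp Require Import all_boot.
From mathcomp Require Import boolp zify.

Set Implicit Arguments.
Unset Strict Implicit.
Unset Printing Implicit Defensive.
Import generic_quotient.

(** The operad of a tree is thin: an operation is determined by its inputs and
    its output ([tree_operad_thin]).  Hence a morphism of Omega is the same
    thing as a map of edges under which the profile (x_1, .., x_n; x) of every
    operation is the profile of an operation ([emap_inj], [emap_exists]).
    The edges of c are the morphisms from the tree with one edge, eta, to c.
    As eta is the only object that maps to every object and has no
    endomorphism but the identity, an autoequivalence F fixes it up to
    isomorphism, and so F induces natural bijections between the edges of c
    and those of F c ([edge_bij]).  A natural endotransformation of the identity
    fixes all edges for the same reason, so it is trivial ([nat_id_unique]).

    The main point is that these bijections preserve profiles.  An operation
    of c is a morphism from a corolla to c, so it suffices to treat the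
    operation that runs through all edges of a corolla.  A corolla has the
    property that every tree with a vertex which embeds into it covers all its
    edges; an equivalence transports this property, and therefore the image of
    a corolla has again an operation through all its edges
    ([F_corolla_profile]).  It remains to see that the root goes to the root.
    If there are at least two leaves, they are exchanged by automorphisms and
    the root is not ([F_corolla_root_or]).  The unary corolla needs a further
    argument, since up to this point its two edges could be exchanged, as they
    are by the reversal of finite ordinals: a binary vertex with a stump
    grafted on one of its inputs has a unary operation which is composed from
    a binary and a nullary one, and these are already known to keep their
    direction ([F_corolla]).

    So the bijections are the components of a natural transformation from the
    identity to F.  Composing it with the one for a quasi-inverse of F gives an
    endotransformation of the identity, which is trivial; hence F is naturally
    isomorphic to the identity ([autoequivalence_nat_iso]).  Isomorphic objects
    of Omega are equal, because the edges and their profiles determine the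
    tree ([Omega_skeletal]); so F is the identity on objects, and then it is
    F_sigma for the family sigma of components ([functor_Fsigma]).  Together
    with the triviality of the endotransformations of the identity this gives
    the theorem for formal reasons, which hold for any category with these two
    properties (section RigidCategory). *)

(** * Permutations of lists *)

Lemma reord_nth (T : Type) (x0 : T) xs s : all (gtn (size xs)) s ->
  reord xs s = map (nth x0 xs) s.
Proof.
elim: s => //= i s IH /andP[ilt /IH]; rewrite /reord /= => ->.
by rewrite onthE (nth_map x0).
Qed.

Lemma reord_iotal n s : all (gtn n) s -> reord (iota 0 n) s = s.
Proof.
move=> sP; rewrite (reord_nth 0) ?size_iota // -[RHS]map_id.
by apply/eq_in_map => i /(allP sP) /= ilt; rewrite nth_iota.
Qed.

Lemma perm_reordP (T : eqType) (xs ys : seq T) : perm_eq xs ys ->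
  exists2 s, is_perm (size xs) s & ys = reord xs s.
Proof.
case: xs => [|x xs]; first by rewrite perm_sym => /perm_nilP->; exists [::].
rewrite perm_sym => /(perm_iotaP x)[s sP ->]; exists s => //.
by rewrite (reord_nth x) ?is_perm_lt.
Qed.

Lemma perm_inv n s : is_perm n s ->
  exists t, [/\ is_perm n t, reord s t = iota 0 n & reord t s = iota 0 n].
Proof.
have inv u : is_perm n u -> exists2 v, is_perm n v & reord u v = iota 0 n.
  move=> uP; have [v vP ->] := perm_reordP uP.
  by exists v; rewrite -?(is_perm_size uP).
move=> sP; have [t tP st] := inv s sP; have [s' sP' ts] := inv t tP.
exists t; split=> //; suff -> : s = s' by [].
rewrite -(reord_iotal (is_perm_lt sP')) -st -reordM ?(is_perm_size sP) ?is_perm_lt //.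
by rewrite ts -(is_perm_size sP) reord_iota.
Qed.

Lemma reord_inj (T : eqType) (xs : seq T) s t : uniq xs ->
  is_perm (size xs) s -> is_perm (size xs) t ->
  reord xs s = reord xs t -> s = t.
Proof.
move=> xsU sP tP; case: xs xsU sP tP => [|x xs] xsU sP tP.
  by rewrite (size0nil (is_perm_size sP)) (size0nil (is_perm_size tP)).
have := is_perm_lt tP; have := is_perm_lt sP; rewrite /is_perm.
move=> {sP tP} sP tP; rewrite !(reord_nth x) //.
elim: s t sP tP => [|i s IH] [|j t] //= /andP[ilt sP] /andP[jlt tP] [ij st].
rewrite (IH t) //; congr cons.
by apply/eqP; rewrite -(@nth_uniq _ x (x :: xs)) //; apply/eqP.
Qed.

(** Undoes a permutation of the inputs: it presents an arbitrary list of
    operations, to be composed with [oact f s], as a reordering of a list that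
    is composable with f. *)
Lemma reord_surj (T : Type) n s (ys : seq T) : is_perm n s -> size ys = n ->
  exists t, [/\ is_perm n t, reord s t = iota 0 n & reord (reord ys t) s = ys].
Proof.
move=> sP ysn; have [t [tP st ts]] := perm_inv sP; exists t; split=> //.
by rewrite -reordM ?ysn ?is_perm_lt // ts -ysn reord_iota.
Qed.

(** * Operations of a free operad *)

Section FreeOperad.
Variables (C : Type) (X : collection C).
Notation P := (free_operad X).

(** The induction principle of the free operad: it is generated by the
    identities and the generators under composition and permutation. *)
Lemma free_op_ind (Q : op P -> Prop) :
  (forall c, Q (oid c)) ->
  (forall g, Q (free_gen g)) ->
  (forall f gs, composable f gs -> Q f -> (forall g, List.In g gs -> Q g) ->
     Q (ocomp f gs)) ->
  (forall f s, is_perm (arity f) s -> Q f -> Q (oact f s)) ->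
  forall f, Q f.
Proof.
move=> Qid Qgen Qcomp Qact F.
rewrite -(qreprK F); case: (qrepr F) => t.
move: t; fix IH 1 => -[c|g|f gs|f s] tP.
- have -> : exist _ (TId X c) tP = wid X c by congr exist; apply: Prop_irrelevance.
  exact: Qid.
- have -> : exist _ (TGen g) tP = wgen g by congr exist; apply: Prop_irrelevance.
  exact: Qgen.
- have [fP gsP fgs] := tP.
  have [ws wsE wsP] : exists2 ws : seq (wterm X), gs = map sval ws &
      forall w, List.In w ws -> Q (qpi (free_rel_congruence X) w).
    elim: gs gsP {tP fgs} => [|g gs IHgs] /=; first by exists [::].
    move=> [gP /IHgs[ws -> wsP]]; exists (exist _ g gP :: ws) => //.
    by move=> w /= [<-|/wsP//]; apply: IH.
  have c : @composable (terms X) (exist _ f fP) ws.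
    by rewrite /composable -[RHS]fgs wsE -map_comp.
  have -> : exist _ (TComp f gs) tP = wcomp (exist _ f fP) ws.
    rewrite /wcomp; case: pselect => // c'.
    apply: eq_exist; by rewrite wsE.
  rewrite -[qpi _ _](@qcompE (terms X) _ (free_rel_congruence X) _ _ c).
  apply: Qcomp; first by apply/qcomposable_pi.
    exact: IH.
  elim: ws wsP {wsE c} => //= w ws IHws wsP g [<-|]; first by apply: wsP; left.
  by apply: IHws => w' w'P; apply: wsP; right.
- have [fP sP] := tP.
  have -> : exist _ (TAct f s) tP = wact (exist _ f fP) s.
    by rewrite /wact; case: pselect => // sP'; apply: eq_exist.
  rewrite -[qpi _ _](@qactE (terms X) _ (free_rel_congruence X) (exist _ f fP) s sP).
  apply: Qact; last exact: IH.
  by rewrite (@qarity_pi (terms X) _ (free_rel_congruence X)).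
Qed.

(** The operations whose tree of generators has a root vertex: g is that
    vertex, fs are the branches above it, and s reorders the leaves. *)
Definition grafted (f : op P) : Prop := exists (g : gen X) fs s,
  [/\ composable (free_gen g) fs, is_perm (arity (ocomp (free_gen g) fs)) s &
      f = oact (ocomp (free_gen g) fs) s].

(** The class of identities and of grafted operations contains the generators
    (by the unit law) and is closed under composition: the equivariance law
    moves the permutation outwards, and associativity moves the composition
    into the branches. *)
Lemma free_op_cases (f : op P) : f = oid (tgt f) \/ grafted f.
Proof.
have laws := operadP P.
elim/free_op_ind: f => [c|g|f gs fgs IHf IHgs|f s sP IHf].
- by left; rewrite tgt_oid.
- right; exists g, (map (@oid P) (src (free_gen g))), (iota 0 (arity (free_gen g))).
  have c := composable_idr (free_gen g).
  rewrite (ocomp_idr laws) (oact1 laws); split=> //.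
  exact: perm_refl.
- case: IHf => [fE|[g [fs [s [gfs sP fE]]]]].
    have := fgs; rewrite {1}fE /composable src_oid.
    case: gs IHgs {fgs} => [|h [|? ?]] // IHgs hf.
    have {}hf : tgt h = tgt f by case: hf.
    have -> : ocomp f [:: h] = h by rewrite {1}fE -hf (ocomp_idl laws).
    by apply: IHgs; left.
  right; have gsn : size gs = arity (ocomp (free_gen g) fs).
    by rewrite (size_composable fgs) fE arity_act.
  have [t [tP st ts]] := reord_surj sP gsn.
  set gs' := reord gs t in ts.
  have c : composable (ocomp (free_gen g) fs) gs'.
    have := fgs; rewrite fE /composable src_oact // => gsE.
    rewrite -reord_map gsE -reordM ?is_perm_lt // st.
    by rewrite /arity reord_iota.
  (* The operations gs' distributed over the branches fs. *)
  pose hss := reshape (map (@arity P) fs) gs'.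
  have szE : sumn (map (@arity P) fs) = size gs'.
    by rewrite (size_composable c) arity_comp.
  have hssE : flatten hss = gs' by rewrite reshapeKr // szE.
  have hssT : map (map (@tgt P)) hss = map (@src P) fs.
    rewrite map_reshape (_ : map (@tgt P) gs' = flatten (map (@src P) fs)).
      by rewrite map_arity flattenK.
    by rewrite [LHS]c src_ocomp.
  have c' := composable_compr gfs hssT.
  exists g, [seq ocomp p.1 p.2 | p <- zip fs hss],
    (block_perm (map (@arity P) gs') s).
  have E : ocomp (ocomp (free_gen g) fs) gs' =
      ocomp (free_gen g) [seq ocomp p.1 p.2 | p <- zip fs hss].
    by rewrite -hssE (ocompA laws).
  split=> //; first by rewrite -E; apply: is_perm_actl.
  by rewrite -E -(ocomp_actl laws c sP) ts fE.
- case: IHf => [fE|[g [fs [u [gfs uP fE]]]]].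
    left; have : is_perm 1 s by move: sP; rewrite /arity fE src_oid.
    move=> /(perm_small_eq (isT : size (iota 0 1) <= 1)) ->.
    rewrite (tgt_oact (_ : is_perm (arity f) [:: 0])); last by rewrite /arity fE src_oid.
    by have := oact1 laws f; rewrite {2}fE /arity src_oid -fE => ->.
  right; exists g, fs, (reord u s); rewrite -(oactM laws) //.
    rewrite fE; split=> //; apply: is_perm_reord => //.
    by move: sP; rewrite fE arity_act.
  by move: sP; rewrite fE arity_act.
Qed.

End FreeOperad.

(** * The geometry of trees *)

Section Graph.
Variables (V : finType) (T : tree V).
Implicit Types (u v w : V) (p q : seq V).

(** ** Paths to the output *)

Definition to_out v p : bool :=
  [&& path (adj T) v p, uniq (v :: p) & last v p == out T].

Lemma to_out_exists v : exists p, to_out v p.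
Proof.
have /connectP[p0 vp] := adj_connected T v (out T).
case/shortenP: vp => q vq qU _ vE; exists q.
by rewrite /to_out vq qU vE eqxx.
Qed.

Lemma to_out_tail v w p : to_out v (w :: p) ->
  [/\ adj T v w, v != out T & to_out w p].
Proof.
case/and3P=> /= /andP[vw wp] /andP[vNp pU] /eqP wo.
split=> //; last by rewrite /to_out wp /= pU wo eqxx.
by apply: contraNneq vNp => ->; rewrite -wo mem_last.
Qed.

(** If the simple paths from v to the output could start with two different
    neighbours of v, then these would be connected in the graph without v, and
    a simple path between them would close up at v to a cycle. *)
Lemma oriented_fun v w w' : oriented T v w -> oriented T v w' -> w = w'.
Proof.
case=> p [/= /andP[vw wp] /andP[vNp pU] po].
case=> p' [/= /andP[vw' wp'] /andP[vNp' pU'] po'].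
apply: contrapT => /eqP ww'.
pose e := [rel x y | [&& adj T x y, x != v & y != v]].
have e_sym : connect_sym e.
  apply: sym_connect_sym => x y /=.
  by rewrite adj_sym [(x != v) && _]andbC.
have eout x q : path (adj T) x q -> v \notin x :: q -> connect e x (last x q).
  move=> xq vNq; apply/connectP; exists q => //.
  elim: q x xq vNq => //= y q IH x /andP[xy yq]; rewrite inE negb_or.
  case/andP=> vx vNq; rewrite IH // andbT xy /=.
  by move: vNq; rewrite inE negb_or !(eq_sym v) in vx * => /andP[-> _]; rewrite vx.
have : connect e w w'.
  apply: (connect_trans (y := out T)); first by rewrite -po; apply: eout.
  by rewrite e_sym -po'; apply: eout.
move=> /connectP[q0 wq0 wE]; move: wE; case/shortenP: wq0 => q wq qU _ wE.
have wqA : path (adj T) w q /\ v \notin q.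
  elim: q w wq {qU wE vw wp vNp pU po ww' p} => //= x q IH w /andP[/and3P[-> _ xv] /IH[-> vNq]].
  by rewrite inE negb_or vNq eq_sym xv.
case: q wq qU wE wqA ww' => [|x q] wq qU wE [wqA vNq] ww'; first by rewrite wE eqxx in ww'.
have /(adj_acyclic)/= : ucycle (adj T) [:: v, w, x & q].
  apply/andP; split; last first.
    rewrite cons_uniq qU andbT inE negb_or vNq andbT.
    by move: vNp; rewrite inE negb_or => /andP[].
  rewrite /cycle rcons_path /= vw.
  move: wqA => /= ->; rewrite /= -[last x q]/(last w (x :: q)) -wE.
  by rewrite adj_sym.
by [].
Qed.

Lemma to_out_uniq v p q : to_out v p -> to_out v q -> p = q.
Proof.
have nil u r : to_out u [::] -> to_out u r -> r = [::].
  case/and3P=> _ _ /eqP /= -> /and3P[_ + /eqP].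
  by case: r => //= x r /andP[+ _] E; rewrite -E mem_last.
elim: p v q => [|w p IH] v q vp vq; first by rewrite (nil _ _ vp vq).
case: q vq => [|w' q] vq; first by have := nil _ _ vq vp.
have or u x r : to_out u (x :: r) -> oriented T u x.
  by case/and3P=> ? ? /eqP ?; exists r.
have E : w = w' by apply: oriented_fun (or _ _ _ vp) (or _ _ _ vq).
case: _ / E in vq *; case/to_out_tail: vp => _ _ wp.
by case/to_out_tail: vq => _ _ wq; rewrite (IH _ _ wp wq).
Qed.

(** [way v] is the unique simple path from v to the output, without its
    starting point v; [par v] is the next vertex on it, and the output is its
    own [par]. *)
Definition way v : seq V := xchoose (to_out_exists v).
Definition par v : V := head (out T) (way v).
Definition depth v : nat := size (way v).

Lemma wayP v : to_out v (way v).
Proof. exact: xchooseP. Qed.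

Lemma way_eq v p : to_out v p -> way v = p.
Proof. exact: to_out_uniq (wayP v). Qed.

Lemma way_out : way (out T) = [::].
Proof. by apply: way_eq; rewrite /to_out /= eqxx. Qed.

Lemma way_par v : v != out T -> way v = par v :: way (par v).
Proof.
move=> vo; have := wayP v; rewrite /par; case: (way v) => [|w p] /=.
  by case/and3P=> _ _ /= vo'; rewrite vo' in vo.
by case/to_out_tail=> _ _ /way_eq ->.
Qed.

Lemma adj_par v : v != out T -> adj T v (par v).
Proof. by move=> vo; have := wayP v; rewrite way_par // => /to_out_tail[]. Qed.

Lemma orientedE v w : oriented T v w <-> v != out T /\ w = par v.
Proof.
split=> [[p [vp pU /eqP po]]|[vo ->]].
  have vwp : to_out v (w :: p) by apply/and3P.
  have [_ vo _] := to_out_tail vwp; split=> //.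
  by rewrite /par (way_eq vwp).
exists (way (par v)); have := wayP v; rewrite way_par //.
by case/and3P=> ? ? /eqP.
Qed.

Lemma depth_out : depth (out T) = 0.
Proof. by rewrite /depth way_out. Qed.

Lemma depth_gt0 v : (0 < depth v) = (v != out T).
Proof.
case: eqVneq => [->|vo]; first by rewrite depth_out.
by rewrite /depth way_par.
Qed.

Lemma depth_par v : depth (par v) = (depth v).-1.
Proof.
case: (eqVneq v (out T)) => [->|vo]; last by rewrite /depth (way_par vo).
by rewrite /par way_out /= depth_out.
Qed.

Lemma depth_iter k v : depth (iter k par v) = depth v - k.
Proof. by elim: k => [|k IH]; rewrite ?subn0 // iterS depth_par IH subnS. Qed.

Lemma depth_lt v : depth v < #|V|.
Proof.
case/and3P: (wayP v) => _ U _; apply: leq_trans (max_card (mem (v :: way v))).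
by rewrite (card_uniqP U).
Qed.

(** If neither end were the parent of the other, then the edge would form a cycle
    with the path from one end to the output, on which the other end lies. *)
Lemma adjE v w :
  adj T v w = ((v != out T) && (par v == w)) || ((w != out T) && (par w == v)).
Proof.
apply/idP/idP=> [vw|]; last first.
  case/orP=> /andP[vo /eqP<-]; first exact: adj_par.
  by rewrite adj_sym; apply: adj_par.
have [|/negP vNw] := boolP (v \in w :: way w); last first.
  have /to_out_tail[_ vo _] : to_out v (w :: way w).
    case/and3P: (wayP w) => wp U wo; apply/and3P; split=> //.
      by rewrite /= vw wp.
    by rewrite cons_uniq U andbT; apply/negP.
  have E : par v = w.
    have : oriented T v w.
      exists (way w); case/and3P: (wayP w) => wp U /eqP wo; split=> //.
        by rewrite /= vw.
      by rewrite cons_uniq U andbT; apply/negP.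
    by case/orientedE.
  by rewrite vo E eqxx.
rewrite inE => /orP[/eqP E|]; first by rewrite E adj_irr in vw.
move=> vw'; apply/orP; right.
have wo : w != out T by apply: contraTneq vw' => ->; rewrite way_out.
rewrite wo /=; have [p1 [p2 wE]] : exists p1 p2, way w = p1 ++ v :: p2.
  by case/splitPr: vw' => p1 p2; exists p1, p2.
have := wayP w; rewrite wE => /and3P[wp U _].
case: p1 wE wp U => [|x p1] wE wp U; first by rewrite /par wE.
have /(adj_acyclic)/= : ucycle (adj T) (w :: rcons (x :: p1) v).
  rewrite -cat_rcons in wp U; rewrite /ucycle; apply/andP; split; last first.
    by move: U; rewrite -cat_cons cat_uniq => /andP[].
  rewrite /cycle rcons_path last_rcons vw andbT.
  by move: wp; rewrite cat_path => /andP[].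
by rewrite size_rcons.
Qed.

Lemma par2 v : v != out T -> par (par v) = v -> False.
Proof.
move=> vo E; have := depth_par (par v); rewrite E depth_par.
by move: vo; rewrite -depth_gt0; lia.
Qed.

(** ** Edges

    An edge is identified with its upper end [top], so that the edges of T are
    the vertices of the graph other than the output. *)

Lemma edge_top_exists (e : edge T) :
  exists v, (v != out T) && (val e == [set v; par v]).
Proof.
case: e => e /= /existsP[v /existsP[w /andP[vw /eqP ->]]].
move: vw; rewrite adjE => /orP[]/andP[o /eqP E]; [exists v|exists w];
  by rewrite o E ?eqxx // setUC eqxx.
Qed.

Definition top (e : edge T) : V := xchoose (edge_top_exists e).

Lemma top_out e : top e != out T.
Proof. by case/andP: (xchooseP (edge_top_exists e)). Qed.

Lemma val_top e : val e = [set top e; par (top e)].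
Proof. by case/andP: (xchooseP (edge_top_exists e)) => _ /eqP. Qed.

Lemma set_par_inj v w : v != out T -> [set v; par v] = [set w; par w] -> v = w.
Proof.
move=> vo E; have : v \in [set w; par w] by rewrite -E set21.
rewrite !inE => /orP[/eqP //|/eqP vE].
have : w \in [set v; par v] by rewrite E set21.
rewrite !inE => /orP[/eqP //|/eqP wE].
by case: (@par2 v); rewrite // -wE.
Qed.

Lemma top_eq (e : edge T) v : v != out T -> val e = [set v; par v] -> top e = v.
Proof. by move=> vo; rewrite val_top => /set_par_inj -> //; apply: top_out. Qed.

Lemma top_inj : injective top.
Proof. by move=> e f E; apply: val_inj; rewrite !val_top E. Qed.

Lemma top_surj v : v != out T -> exists e, top e = v.
Proof.
move=> vo; have eP : is_edge T [set v; par v].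
  by apply/existsP; exists v; apply/existsP; exists (par v); rewrite adj_par ?eqxx.
by exists (Sub [set v; par v] eP); apply: top_eq.
Qed.

Lemma output_edgeE v e : output_edge v e <-> top e = v.
Proof.
split=> [[w [/orientedE[vo ->]]]|<-]; first exact: top_eq.
exists (par (top e)); split; last exact: val_top.
by apply/orientedE; split=> //; apply: top_out.
Qed.

Lemma input_edgeE v e : input_edge v e <-> par (top e) = v.
Proof.
split=> [[w [/orientedE[wo ->] /(top_eq wo) ->]]|<-] //.
exists (top e); split; last exact: val_top.
by apply/orientedE; split=> //; apply: top_out.
Qed.

Definition child (x y : edge T) : bool := par (top x) == top y.
Definition leaf (x : edge T) : bool := top x \in ins T.
Definition above (x y : edge T) : Prop := exists k, iter k par (top x) = top y.

Lemma edepth_gt0 x : 0 < depth (top x).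
Proof. by rewrite depth_gt0 top_out. Qed.

Lemma child_depth x y : child x y -> depth (top x) = (depth (top y)).+1.
Proof.
move=> /eqP E; have := depth_par (top x); rewrite E.
by have := edepth_gt0 y; lia.
Qed.

(** An input has only one neighbour, and its parent is one. *)
Lemma leaf_child x y : leaf y -> child x y = false.
Proof.
move=> yl; apply/negP => xy; have /eqP/cards1P[z zE] := ins_outer yl.
have : top x \in [set w | adj T (top y) w].
  by rewrite inE adjE !top_out (eqP xy) eqxx orbT.
have : par (top y) \in [set w | adj T (top y) w].
  by rewrite inE adj_par // top_out.
rewrite zE !inE => /eqP <- /eqP E.
by case: (@par2 (top x)); rewrite ?top_out // (eqP xy).
Qed.

Lemma above_refl x : above x x. Proof. by exists 0. Qed.

Lemma above_trans x y z : above x y -> above y z -> above x z.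
Proof. by move=> [k xy] [l yz]; exists (l + k); rewrite iterD xy. Qed.

Lemma child_above x y : child x y -> above x y.
Proof. by move=> /eqP xy; exists 1. Qed.

Lemma above_depth k x y : iter k par (top x) = top y ->
  depth (top x) = depth (top y) + k.
Proof.
move=> E; have := depth_iter k (top x); rewrite E.
by have := edepth_gt0 y; lia.
Qed.

Lemma above_antisym x y : above x y -> above y x -> x = y.
Proof.
move=> [k xy] [l yx]; have := above_depth xy; have := above_depth yx.
move=> E1 E2; have k0 : k = 0 by lia.
by apply: top_inj; rewrite -xy k0.
Qed.

(** The path from z to the output meets each depth only once. *)
Lemma above_same_depth z x y : above z x -> above z y ->
  depth (top x) = depth (top y) -> x = y.
Proof.
move=> [k zx] [l zy] E; have := above_depth zx; have := above_depth zy.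
by move=> E1 E2; have kl : k = l by [lia]; apply: top_inj; rewrite -zx -zy kl.
Qed.

Lemma iter_par_step k x y : iter k.+1 par (top x) = top y ->
  exists2 z, child x z & iter k par (top z) = top y.
Proof.
move=> E; have [o|/top_surj[z zE]] := eqVneq (par (top x)) (out T).
  have := depth_iter k (par (top x)); rewrite -iterSr E o depth_out sub0n.
  by move/eqP; rewrite -leqn0 leqNgt edepth_gt0.
by exists z; rewrite /child zE // -iterSr.
Qed.

Lemma root_exists : exists r, forall x, above x r.
Proof.
have /eqP/cards1P[w oE] := out_outer T.
have E v : adj T (out T) v = (v == w).
  by have /setP/(_ v) := oE; rewrite !inE.
have [r rE] : exists r, top r = w.
  by apply: top_surj; have := E w; rewrite eqxx; apply: contraTneq => ->; rewrite adj_irr.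
exists r => x; exists (depth (top x)).-1.
have : depth (top x) = 1 + (depth (top x)).-1 by have := edepth_gt0 x; lia.
move: (_.-1) => k; elim: k (top x) (top_out x) => [|k IH] v vo d.
  have /eqP vp : par v == out T by rewrite -[_ == _]negbK -depth_gt0 depth_par d.
  by rewrite rE /=; apply/eqP; rewrite -E adjE eqxx vo vp eqxx.
rewrite iterSr; apply: IH; last by rewrite depth_par d.
by rewrite -depth_gt0 depth_par d.
Qed.

Lemma tgen_nonleaf (g : tgen T) : ~~ leaf (tgen_out g).
Proof.
have /output_edgeE E := tgen_outP g; rewrite /leaf E.
by case/andP: (tgen_vertexP g).
Qed.

Lemma mem_tgen (g : tgen T) x : (x \in tgen_ins g) = child x (tgen_out g).
Proof.
have /output_edgeE E := tgen_outP g; rewrite /child E.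
by apply/idP/eqP => [/tgen_insP/input_edgeE //|xv]; apply/tgen_insP/input_edgeE.
Qed.

Lemma tgen_exists y xs : ~~ leaf y -> uniq xs ->
  (forall x, (x \in xs) = child x y) ->
  exists g : tgen T, tgen_ins g = xs /\ tgen_out g = y.
Proof.
move=> yl xsU xsE.
have vP : is_vertex T (top y) by rewrite /is_vertex top_out.
have oP : output_edge (top y) y by apply/output_edgeE.
have iP x : x \in xs <-> input_edge (top y) x.
  by rewrite xsE; split=> [/eqP/input_edgeE//|/input_edgeE/eqP].
by exists (TGenerator vP oP xsU iP).
Qed.

Lemma tgen_of y : ~~ leaf y -> exists g : tgen T, tgen_out g = y.
Proof.
move=> yl; have [] := @tgen_exists y (enum [pred x | child x y]) yl.
- exact: enum_uniq.
- by move=> x; rewrite mem_enum inE.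
by move=> g [_ E]; exists g.
Qed.

Lemma tgen_eqP (g h : tgen T) : tgen_out g = tgen_out h ->
  tgen_ins g = tgen_ins h -> g = h.
Proof.
move=> oE iE; apply: tgen_ext => //.
have /output_edgeE := tgen_outP g; have /output_edgeE := tgen_outP h.
by rewrite oE => -> ->.
Qed.

End Graph.

(** * Operads of trees are thin *)

(* Simplification would otherwise expand the operads into quotients of terms. *)
#[local] Arguments op : simpl never.
#[local] Arguments col : simpl never.
#[local] Arguments src : simpl never.
#[local] Arguments tgt : simpl never.

Section TreeOperad.
Variables (V : finType) (T : tree V).
Notation P := (tree_operad T).
Notation E := (edge T).
Notation vop g := (@free_gen _ (tree_collection T) g).
Implicit Types (x y : E) (f : op P).

(** Induction from the leaves to the root, possible because the depth is
    bounded. *)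
Lemma child_ind (Q : E -> Prop) :
  (forall y, (forall x, child x y -> Q x) -> Q y) -> forall y, Q y.
Proof.
move=> QP y; have [n] := ubnP (#|V| - depth T (top y)).
elim: n y => // n IH y yn; apply: QP => x xy; apply: IH.
have := child_depth xy; have := depth_lt T (top y); have := depth_lt T (top x).
by move: yn; lia.
Qed.

Lemma mem_flatten_src (fs : seq (op P)) x :
  x \in flatten (map (@src P) fs) -> exists2 f, List.In f fs & x \in (src f : seq E).
Proof.
elim: fs => //= f fs IH; rewrite mem_cat => /orP[xf|/IH[h hfs xh]].
  by exists f; [left|].
by exists h; [right|].
Qed.

Lemma In_tgt (fs : seq (op P)) f : List.In f fs -> tgt f \in (map (@tgt P) fs : seq E).
Proof.
elim: fs => //= h fs IH [->|/IH]; rewrite inE ?eqxx // => ->.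
by rewrite orbT.
Qed.

(** This is what makes the operad of a tree directed: it yields antisymmetry,
    and the inputs of different branches stay apart. *)
Lemma src_above f x : x \in (src f : seq E) -> above x (tgt f).
Proof.
elim/free_op_ind: f x => [c|g|f gs fgs IHf IHgs|f s sP IHf] x.
- by rewrite src_oid tgt_oid mem_seq1 => /eqP->; apply: above_refl.
- by rewrite free_gen_src free_gen_tgt /= mem_tgen; apply: child_above.
- rewrite (src_ocomp fgs) (tgt_ocomp fgs) => /mem_flatten_src[h hgs xh].
  apply: (above_trans (IHgs h hgs x xh)); apply: IHf.
  by rewrite -fgs; apply: In_tgt.
- rewrite (src_oact sP) (tgt_oact sP) (perm_mem (@perm_reord E (src f) s sP)).
  exact: IHf.
Qed.

Lemma graftedE f : grafted f -> exists (g : tgen T) fs s,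
  [/\ composable (vop g) fs,
      is_perm (arity (ocomp (vop g) fs)) s,
      f = oact (ocomp (vop g) fs) s,
      tgt f = tgen_out g & map (@tgt P) fs = tgen_ins g].
Proof.
case=> g [fs [s [gfs sP fE]]]; exists g, fs, s; split=> //.
  by rewrite fE (tgt_oact sP) (tgt_ocomp gfs) free_gen_tgt.
by rewrite [LHS]gfs free_gen_src.
Qed.

Lemma grafted_src g fs s (f : op P) :
  composable (vop g) fs ->
  is_perm (arity (ocomp (vop g) fs)) s ->
  f = oact (ocomp (vop g) fs) s ->
  perm_eq (src f : seq E) (flatten (map (@src P) fs)).
Proof.
move=> gfs sP ->; rewrite (src_oact sP) -(src_ocomp gfs).
exact: (@perm_reord E).
Qed.

Lemma uniq_flatten_src y (fs : seq (op P)) :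
  uniq (map (@tgt P) fs : seq E) ->
  (forall x, x \in (map (@tgt P) fs : seq E) -> child x y) ->
  (forall f, List.In f fs -> uniq (src f : seq E)) ->
  uniq (flatten (map (@src P) fs) : seq E).
Proof.
elim: fs => //= f fs IH /andP[fN fsU] ch srcU; rewrite cat_uniq; apply/and3P; split.
- by apply: srcU; left.
- apply/hasPn => x /mem_flatten_src[h hfs xh]; apply: contra fN => xf.
  suff -> : tgt f = tgt h by apply: In_tgt.
  apply: (above_same_depth (src_above xf) (src_above xh)).
  rewrite (child_depth (ch (tgt f) _)) ?mem_head //.
  by rewrite (child_depth (ch (tgt h) _)) // inE In_tgt ?orbT.
- apply: IH => // [x xfs|h hfs]; first by apply: ch; rewrite inE xfs orbT.
  by apply: srcU; right.
Qed.

Lemma uniq_src f : uniq (src f : seq E).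
Proof.
move: {2}(tgt f : E) (erefl (tgt f : E)) => y; elim/child_ind: y f => y IH f fy.
case: (free_op_cases f) => [->|]; first by rewrite src_oid.
case/graftedE=> g [fs [s [gfs sP fE fg fsE]]].
have ch x : x \in (map (@tgt P) fs : seq E) -> child x y.
  by rewrite fsE mem_tgen -fg fy.
rewrite (perm_uniq (grafted_src gfs sP fE)); apply: (@uniq_flatten_src y) => //.
  by rewrite fsE; apply: tgen_uniq.
by move=> h hfs; apply: (IH (tgt h)) => //; apply: ch; apply: In_tgt.
Qed.

(** Two families of branches over the same inputs of a vertex y, with the same
    leaves altogether, agree up to reordering the leaves of each branch.  A leaf
    of the whole belongs to the branch over the one input below it, so each pair
    of branches has the same leaves, and [thin] applies to it. *)
Lemma split_leaves y (fs hs : seq (op P)) :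
  (forall f h : op P, child (tgt f) y -> tgt f = tgt h -> src f = src h -> f = h) ->
  map (@tgt P) fs = map (@tgt P) hs -> uniq (map (@tgt P) fs : seq E) ->
  (forall x, x \in (map (@tgt P) fs : seq E) -> child x y) ->
  perm_eq (flatten (map (@src P) fs) : seq E) (flatten (map (@src P) hs)) ->
  exists2 us, all2 is_perm (map (@arity P) fs) us &
              hs = [seq oact p.1 p.2 | p <- zip fs us].
Proof.
move=> thin; elim: fs hs => [|f fs IH] [|h hs] //; first by exists [::].
move=> tE /andP[fN fsU] ch pE.
have fh : tgt f = tgt h by case: tE.
have fshs : map (@tgt P) fs = map (@tgt P) hs by case: tE.
have fy : child (tgt f) y by apply: ch; rewrite mem_head.
have chs x : x \in (map (@tgt P) fs : seq E) -> child x y.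
  by move=> xfs; apply: ch; rewrite inE xfs orbT.
pose a (x : E) := `[< above x (tgt f) >].
have aT (k : op P) : tgt k = tgt f -> filter a (src k) = src k.
  move=> kf; apply/all_filterP/allP => x xk; apply/asboolP; rewrite -kf.
  exact: src_above.
have aF (ks : seq (op P)) : map (@tgt P) ks = map (@tgt P) fs ->
    filter a (flatten (map (@src P) ks)) = [::].
  move=> ksE; apply/eqP; rewrite -[_ == _]negbK -has_filter; apply/negP.
  case/hasP=> x /mem_flatten_src[k kks xk] /asboolP xf.
  have kfs : tgt k \in (map (@tgt P) fs : seq E) by rewrite -ksE; apply: In_tgt.
  case/negP: fN; suff -> : tgt f = tgt k by [].
  apply: (above_same_depth xf (src_above xk)).
  by rewrite (child_depth fy) (child_depth (chs _ kfs)).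
have pfh : perm_eq (src f : seq E) (src h).
  have := perm_filter a pE; rewrite /= !filter_cat.
  by rewrite (aT f) // (aT h) ?fh // (aF fs) // (aF hs) // !cats0.
have {}pE : perm_eq (flatten (map (@src P) fs) : seq E) (flatten (map (@src P) hs)).
  by have := pE; rewrite /= (permPl (_ : perm_eq _ (src h ++ flatten (map (@src P) fs)))) ?perm_cat2l // perm_cat2r.
have [us usP hsE] := IH hs fshs fsU chs pE.
have [u uP hE] := perm_reordP pfh.
exists (u :: us) => /=; first by rewrite uP.
congr cons => //; apply: esym; apply: thin.
- by rewrite (tgt_oact uP).
- by rewrite (tgt_oact uP).
- by rewrite (src_oact uP).
Qed.

(** By induction on the output edge y, from the leaves down.  An identity and a
    grafted operation are told apart by depth.  Two grafted operations with
    output y have the same root vertex, so their generators differ by a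
    permutation, which is absorbed into the branches and the outer permutation;
    the branches then agree up to permutations by induction ([split_leaves]).
    What remains are two permutations of one list of leaves with the same
    result, and they are equal as the leaves are distinct. *)
Lemma tree_operad_thin (f h : op P) : src f = src h -> tgt f = tgt h -> f = h.
Proof.
have laws := operadP P.
move: {2}(tgt f : E) (erefl (tgt f : E)) => y; elim/child_ind: y f h => y IH f h fy sfh tfh.
have notid (k k' : op P) : src k = src k' -> tgt k = tgt k' -> k = oid (tgt k) ->
    grafted k' -> False.
  move=> sE tE kE /graftedE[g [fs [s [gfs sP k'E k'g fsE]]]].
  have : tgt k \in (src k' : seq E) by rewrite -sE kE src_oid tgt_oid mem_head.
  rewrite (perm_mem (grafted_src gfs sP k'E)) => /mem_flatten_src[l lfs /src_above kl].
  have := In_tgt lfs; rewrite fsE mem_tgen -k'g -tE => lk.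
  have lE : tgt l = tgt k by apply: above_antisym kl; apply: child_above.
  by have := child_depth lk; rewrite lE; lia.
case: (free_op_cases f) => [fE|fG].
  case: (free_op_cases h) => [hE|hG]; first by rewrite fE hE tfh.
  by case: (notid f h).
case: (free_op_cases h) => [hE|hG]; first by case: (notid h f).
have {fG}[g [fs [s [gfs sP fE fg fsE]]]] := graftedE fG.
have {hG}[g' [hs [t [ghs tP hE hg hsE]]]] := graftedE hG.
have gg' : tgen_out g' = tgen_out g by rewrite -fg -hg.
have [p pP insE] : exists2 p, is_perm (size (tgen_ins g)) p &
    tgen_ins g' = reord (tgen_ins g) p.
  apply: perm_reordP; apply: uniq_perm; rewrite ?tgen_uniq // => x.
  by rewrite !mem_tgen gg'.
have pP' : is_perm (arity (vop g)) p.
  by rewrite /arity free_gen_src.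
have g'E : vop g' =
    oact (vop g) p.
  rewrite free_gen_act //; congr free_gen; apply: tgen_eqP => //=.
  by rewrite /permute_ins pP.
have hsn : size hs = arity (vop g).
  by rewrite (size_composable ghs) g'E arity_act.
have [q [qP pq qp]] := reord_surj pP' hsn.
(* The branches of h over the inputs of g in the order chosen by g. *)
set ks := reord hs q in qp.
have gks : composable (vop g) ks.
  rewrite /composable -reord_map [map _ hs]ghs g'E src_oact //.
  by rewrite -reordM ?is_perm_lt // pq reord_iota.
have ksE : map (@tgt P) ks = tgen_ins g by rewrite [LHS]gks free_gen_src.
pose bp := block_perm (map (@arity P) ks) p.
have bpP := is_perm_actl gks pP'; rewrite -/bp in bpP.
have E1 : ocomp (vop g') hs =
    oact (ocomp (vop g) ks) bp.
  by rewrite g'E -qp (ocomp_actl laws).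
rewrite E1 in hE tP; rewrite arity_act // in tP.
have {}hE : h = oact (ocomp (vop g) ks) (reord bp t).
  by rewrite hE (oactM laws).
have {tP bpP}rP := is_perm_reord bpP tP.
move: (reord bp t) hE rP => {E1 pq qp}r hE rP.
have [|||||us usP ksfs] := @split_leaves y fs ks.
- by move=> k l ky kl skl; apply: (IH (tgt k)) => //; rewrite kl.
- by rewrite fsE ksE.
- by rewrite fsE tgen_uniq.
- by move=> x; rewrite fsE mem_tgen -fg fy.
- have := grafted_src gfs sP fE; rewrite perm_sym => pf; apply: (perm_trans pf).
  by rewrite sfh; apply: grafted_src gks rP hE.
have psP := is_perm_actr gfs usP.
have E2 := ocomp_actr laws gfs usP; rewrite -ksfs in E2.
have rP' : is_perm (arity (ocomp (vop g) fs)) r.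
  by move: rP; rewrite E2 arity_act.
rewrite E2 (oactM laws) // in hE.
have mP := is_perm_reord psP rP'.
move: (reord _ r) hE mP => m hE mP.
rewrite fE hE; congr oact; apply: (@reord_inj E _ _ _ _ sP mP).
  exact: uniq_src.
by have := sfh; rewrite fE hE (src_oact sP) (src_oact mP).
Qed.

End TreeOperad.

(** * Profiles and morphisms *)

Section Profiles.
Variables (V : finType) (T : tree V).
Notation P := (tree_operad T).
Notation E := (edge T).
Implicit Types (x y : E) (xs ys zs : seq E).

(** As the operad of a tree is thin, this relation is the whole operad. *)
Definition profile xs x : Prop := exists f : op P, src f = xs /\ tgt f = x.

Lemma profile_id x : profile [:: x] x.
Proof. by exists (@oid P x); rewrite src_oid tgt_oid. Qed.

Lemma profile_gen (g : tgen T) : profile (tgen_ins g) (tgen_out g).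
Proof.
exists (@free_gen _ (tree_collection T) g).
by rewrite free_gen_src free_gen_tgt.
Qed.

Lemma profile_perm xs ys x : perm_eq xs ys -> profile xs x -> profile ys x.
Proof.
move=> /perm_reordP[s sP ->] [f [fxs fx]].
have sP' : is_perm (size (src f)) s by rewrite fxs.
by exists (oact f s); rewrite (src_oact sP') (tgt_oact sP') fxs.
Qed.

Lemma profile_graft xs y zs ys x :
  profile (xs ++ y :: zs) x -> profile ys y -> profile (xs ++ ys ++ zs) x.
Proof.
move=> [f [fE fx]] [h [hE hy]].
pose gs := map (@oid P) xs ++ h :: map (@oid P) zs.
have idE (us : seq E) : map (@tgt P) (map (@oid P) us) = us.
  by rewrite -map_comp -[RHS]map_id; apply: eq_map => u /=; rewrite tgt_oid.
have idS (us : seq E) : flatten (map (@src P) (map (@oid P) us)) = us.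
  rewrite -map_comp (eq_map (g := fun c => [:: c])) ?flatten_seq1 //.
  by move=> c /=; rewrite src_oid.
have c : composable f gs by rewrite /composable map_cat /= !idE hy.
exists (ocomp f gs); rewrite (src_ocomp c) (tgt_ocomp c) fx; split=> //.
by rewrite map_cat flatten_cat /= !idS hE.
Qed.

Lemma profile_above xs x y : profile xs x -> y \in xs -> above y x.
Proof. by move=> [f [<- <-]]; apply: src_above. Qed.

Lemma profile_antisym xs ys x y :
  profile xs x -> y \in xs -> profile ys y -> x \in ys -> x = y.
Proof.
by move=> xsx yxs ysy xys; apply: above_antisym; [apply: profile_above ysy xys|
  apply: profile_above xsx yxs].
Qed.

Lemma child_profile y x : child y x -> exists2 xs, profile xs x & y \in xs.
Proof.
move=> yx; have xl : ~~ leaf x by apply: contraL yx => xl; rewrite leaf_child.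
have [g gx] := tgen_of xl; exists (tgen_ins g); first by rewrite -gx; apply: profile_gen.
by rewrite mem_tgen gx.
Qed.

Lemma above_profile y x : above y x -> exists2 xs, profile xs x & y \in xs.
Proof.
case=> k; elim: k y => [|k IH] y E0.
  by exists [:: x]; [apply: profile_id|rewrite (top_inj E0) mem_seq1].
have [z yz /IH[xs xsx zxs]] := iter_par_step E0.
have [ys ysz yys] := child_profile yz.
case/splitPr: zxs xsx => xs1 xs2 xsx; exists (xs1 ++ ys ++ xs2).
  exact: profile_graft xsx ysz.
by rewrite !mem_cat yys orbT.
Qed.

Lemma profile_cases xs x : profile xs x -> xs = [:: x] \/
  exists (g : tgen T) (fs : seq (op P)), [/\ tgen_out g = x,
    map (@tgt P) fs = tgen_ins g & perm_eq xs (flatten (map (@src P) fs))].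
Proof.
move=> [f [<- <-]]; case: (free_op_cases f) => [fE|].
  by left; rewrite {1}fE src_oid.
case/graftedE=> g [fs [s [gfs sP fE fg fsE]]]; right; exists g, fs; split=> //.
exact: grafted_src gfs sP fE.
Qed.

Lemma profile_uniq xs x : profile xs x -> uniq xs.
Proof. by move=> [f [<- _]]; apply: uniq_src. Qed.

(** Characterizes leaves by the operad alone; it separates a leaf from an edge
    with a nullary vertex on top, which the order on edges cannot do. *)
Lemma leaf_profile x : leaf x <-> forall xs, profile xs x -> xs = [:: x].
Proof.
split=> [xl xs /profile_cases[//|[g [fs [gx _ _]]]]|xsE].
  by have := tgen_nonleaf g; rewrite gx xl.
apply: contrapT => /negP/tgen_of[g gx]; have := profile_gen g.
rewrite gx => /xsE insE; have : x \in tgen_ins g by rewrite insE mem_seq1.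
by rewrite mem_tgen gx => /child_depth; lia.
Qed.

Lemma profile_corolla xs x : (forall y, child y x -> leaf y) -> profile xs x ->
  xs = [:: x] \/ forall y, (y \in xs) = child y x.
Proof.
move=> chl /profile_cases[|[g [fs [gx fsE xsE]]]]; [by left|right=> y].
suff fsF : flatten (map (@src P) fs) = tgen_ins g.
  by rewrite (perm_mem xsE) fsF mem_tgen gx.
have : all (@leaf _ T) (tgen_ins g) by apply/allP => z; rewrite mem_tgen gx => /chl.
rewrite -fsE; elim: fs {fsE xsE} => //= f fs IH /andP[fl /IH ->].
have /leaf_profile/(_ (src f)) -> := fl; first by [].
by exists f.
Qed.

Lemma tgen_uniq_all (g : tgen T) : uniq (tgen_out g :: tgen_ins g).
Proof.
rewrite /= tgen_uniq andbT mem_tgen; apply/negP => /child_depth; lia.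
Qed.

(** A tree without vertices, or the corolla of one of its vertices. *)
Lemma tree_vertexless_or : (forall xs x, profile xs x -> xs = [:: x]) \/
  exists xs x, profile xs x /\ uniq (x :: xs).
Proof.
have [al|/existsNP[x /negP/tgen_of[g _]]] := pselect (forall x : E, leaf x).
  by left=> xs x; move: xs; apply/leaf_profile.
right; exists (tgen_ins g), (tgen_out g); split; first exact: profile_gen.
exact: tgen_uniq_all.
Qed.

Lemma root_profile : exists r, forall x, exists2 xs, profile xs r & x \in xs.
Proof.
have [r rP] := root_exists T; exists r => x; exact: above_profile.
Qed.

(** A child is a covering in the order, so the order determines the tree. *)
Lemma childE x y : child x y <->
  [/\ x <> y, above x y & forall z, above x z -> above z y -> z = x \/ z = y].
Proof.
split=> [xy|[xy [[|k] E] cov]]; last 1 first.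
- by have [z xz zy] := iter_par_step E; case: (cov z) => [||zx|<-//];
    [exact: child_above|by exists k|move: xz; rewrite zx => /child_depth; lia].
- split; first by move=> E; move: xy; rewrite E => /child_depth; lia.
    exact: child_above.
  move=> z [k xz] [l zy]; have := above_depth xz; have := above_depth zy.
  have := child_depth xy; move=> E1 E2 E3.
  have [k0|l0] : k = 0 \/ l = 0 by lia.
    by left; apply: top_inj; rewrite -xz k0.
  by right; apply: top_inj; rewrite -zy l0.
- by case: xy; apply: top_inj.
Qed.

Lemma par_outE x : par T (top x) = out T <-> forall y, above x y -> y = x.
Proof.
split=> [xo y [[|k] E]|xtop]; first by apply: top_inj.
  have := depth_iter T k (par T (top x)); rewrite -iterSr E xo depth_out sub0n.
  by move/eqP; rewrite -leqn0 leqNgt edepth_gt0.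
apply: contrapT => /eqP/top_surj[z zE].
have xz : child x z by rewrite /child zE.
by have := child_depth xz; rewrite (xtop z (child_above xz)); lia.
Qed.

End Profiles.

Arguments profile {V T}.

Section Homs.
Variables (V W : finType) (S : tree V) (T : tree W).
Notation hom_op := (operad_hom (tree_operad S) (tree_operad T)).

Lemma hom_profile (phi : hom_op) (xs : seq (edge S)) x :
  profile xs x -> profile (map (hcol phi) xs : seq (edge T)) (hcol phi x).
Proof. by move=> [f [<- <-]]; exists (hop phi f); rewrite hop_src hop_tgt. Qed.

Lemma tree_hom_ext (phi psi : hom_op) : hcol phi =1 hcol psi -> phi = psi.
Proof.
move=> E; apply: operad_hom_ext => // f; apply: tree_operad_thin.
  by rewrite !hop_src; apply: eq_map.
by rewrite !hop_tgt E.
Qed.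

(** Thinness makes any choice of images of the generators equivariant. *)
Lemma tree_hom_exists (h : edge S -> edge T) :
  (forall g : tgen S, profile (map h (tgen_ins g)) (h (tgen_out g))) ->
  exists phi : hom_op, hcol phi = h.
Proof.
move=> /choice[k kP].
have k_src (g : gen (tree_collection S)) : src (k g) = map h (gsrc g).
  by case: (kP g).
have k_tgt (g : gen (tree_collection S)) : tgt (k g) = h (gtgt g).
  by case: (kP g).
have k_act (g : gen (tree_collection S)) s : is_perm (size (gsrc g)) s ->
    k (gact g s) = oact (k g) s.
  move=> sP; have sP' : is_perm (size (src (k g))) s by rewrite k_src size_map.
  apply: tree_operad_thin.
    by rewrite (src_oact sP') !k_src (gsrc_act sP) reord_map.
  by rewrite (tgt_oact sP') !k_tgt (gtgt_act sP).
by exists (@free_ext _ (tree_collection S) (tree_operad T) h k k_src k_tgt k_act).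
Qed.

End Homs.


(** * Isomorphic operads come from isomorphic trees *)

Section EdgeMap.
Variables (V W : finType) (S : tree V) (T : tree W).
Variables (h : edge S -> edge T) (k : edge T -> edge S).
Hypotheses (hK : cancel h k) (kK : cancel k h).
Hypothesis hP : forall xs x, profile xs x -> profile (map h xs) (h x).
Hypothesis kP : forall xs x, profile xs x -> profile (map k xs) (k x).

Lemma edge_map_above x y : above x y <-> above (h x) (h y).
Proof.
split=> [/above_profile[xs /hP xsy xxs]|/above_profile[xs /kP]].
  by apply: profile_above xsy _; apply: map_f.
by rewrite hK => xsy /(map_f k); rewrite hK; apply: profile_above xsy.
Qed.

Lemma edge_map_child x y : child x y <-> child (h x) (h y).
Proof.
have hI := can_inj hK; have hA := edge_map_above.
split=> /childE[xy xAy cov]; apply/childE; split.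
- by move/hI.
- exact/hA.
- move=> z; rewrite -(kK z) => /hA xz /hA zy.
  by case: (cov _ xz zy) => ->; [left|right].
- by move=> E; apply: xy; rewrite E.
- exact/hA.
- move=> z /hA xz /hA zy.
  by case: (cov _ xz zy) => /hI ->; [left|right].
Qed.

Lemma edge_map_leaf x : leaf (h x) = leaf x.
Proof.
apply/idP/idP => /leaf_profile lx; apply/leaf_profile => xs xsx.
  by apply: (inj_map (can_inj hK)); rewrite /= (lx _ (hP xsx)).
have := kP xsx; rewrite hK => /lx E.
by rewrite -[xs](mapK kK) E.
Qed.

Lemma edge_map_par_out x : par S (top x) = out S <-> par T (top (h x)) = out T.
Proof.
split=> /par_outE xtop; apply/par_outE => y.
  by rewrite -(kK y) => /edge_map_above/xtop ->.
by move=> /edge_map_above/xtop/(can_inj hK).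
Qed.

(** A vertex moves with the edge below it; the output is the only one without
    such an edge. *)
Definition vertex_map (v : V) : W :=
  if [pick e : edge S | top e == v] is Some e then top (h e) else out T.

Lemma vertex_map_top x : vertex_map (top x) = top (h x).
Proof.
rewrite /vertex_map; case: pickP => [y /eqP /top_inj -> //|/(_ x)].
by rewrite eqxx.
Qed.

Lemma vertex_map_out : vertex_map (out S) = out T.
Proof.
rewrite /vertex_map; case: pickP => // y /eqP E.
by have := top_out y; rewrite E eqxx.
Qed.

Lemma vertex_map_neq_out v : (vertex_map v != out T) = (v != out S).
Proof.
have [->|/top_surj[x <-]] := eqVneq v (out S); first by rewrite vertex_map_out eqxx.
by rewrite vertex_map_top top_out.
Qed.

Lemma vertex_map_par v : v != out S -> vertex_map (par S v) = par T (vertex_map v).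
Proof.
move=> /top_surj[x <-]; rewrite vertex_map_top.
have [xo|/top_surj[y yE]] := eqVneq (par S (top x)) (out S).
  by rewrite xo vertex_map_out; apply/esym/edge_map_par_out.
rewrite -yE vertex_map_top; apply/esym/eqP/edge_map_child.
by rewrite /child yE.
Qed.

Lemma vertex_map_ins v : (vertex_map v \in ins T) = (v \in ins S).
Proof.
have [->|/top_surj[x <-]] := eqVneq v (out S).
  by rewrite vertex_map_out !(negPf (out_notin _)).
by rewrite vertex_map_top; apply: edge_map_leaf.
Qed.

End EdgeMap.

Lemma vertex_mapK (V W : finType) (S : tree V) (T : tree W)
    (h : edge S -> edge T) (k : edge T -> edge S) : cancel h k ->
  cancel (vertex_map h) (vertex_map k).
Proof.
move=> hK v; have [->|/top_surj[x <-]] := eqVneq v (out S).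
  by rewrite !vertex_map_out.
by rewrite !vertex_map_top hK.
Qed.

Lemma vertex_map_adj (V W : finType) (S : tree V) (T : tree W)
    (h : edge S -> edge T) (k : edge T -> edge S) :
  cancel h k -> cancel k h ->
  (forall xs x, profile xs x -> profile (map h xs) (h x)) ->
  (forall xs x, profile xs x -> profile (map k xs) (k x)) ->
  forall v w, adj T (vertex_map h v) (vertex_map h w) = adj S v w.
Proof.
move=> hK kK hP kP v w; rewrite !adjE !vertex_map_neq_out.
have inj := can_inj (vertex_mapK hK).
have half u u' : (u != out S) && (par T (vertex_map h u) == vertex_map h u') =
                 (u != out S) && (par S u == u').
  case: (boolP (u != out S)) => //= uo.
  by rewrite -(vertex_map_par hK kK hP kP uo) (inj_eq inj).
by rewrite !half.
Qed.

(** * Isomorphic trees have isomorphic operads *)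

Section Renaming.
Variables (V W : finType) (S : tree V) (T : tree W) (f : V -> W) (g : W -> V).
Hypotheses (fK : cancel f g) (gK : cancel g f).
Hypothesis f_adj : forall v w, adj T (f v) (f w) = adj S v w.
Hypothesis f_out : f (out S) = out T.
Hypothesis f_ins : forall v, (f v \in ins T) = (v \in ins S).

Lemma rename_par v : par T (f v) = f (par S v).
Proof.
rewrite /par -f_out (@way_eq _ T (f v) (map f (way S v))); first by case: (way S v).
case/and3P: (wayP S v) => vp U /eqP vo; apply/and3P; split.
- by rewrite (mono_path f_adj).
- by rewrite -map_cons (map_inj_uniq (can_inj fK)).
- by rewrite last_map vo f_out.
Qed.

Lemma rename_exists : exists h : edge S -> edge T, forall x, top (h x) = f (top x).
Proof.
suff /choice[h hP] : forall x : edge S, exists y : edge T, top y = f (top x).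
  by exists h.
by move=> x; apply: top_surj; rewrite -f_out (inj_eq (can_inj fK)) top_out.
Qed.

Lemma rename_child (h : edge S -> edge T) : (forall x, top (h x) = f (top x)) ->
  forall x y, child (h x) (h y) = child x y.
Proof. by move=> hP x y; rewrite /child !hP rename_par (inj_eq (can_inj fK)). Qed.

End Renaming.

Lemma rename_profile (V W : finType) (S : tree V) (T : tree W)
    (h : edge S -> edge T) (k : edge T -> edge S) :
  cancel h k -> cancel k h ->
  (forall x y, child (h x) (h y) = child x y) ->
  (forall x, leaf (h x) = leaf x) ->
  exists phi : operad_hom (tree_operad S) (tree_operad T), hcol phi = h.
Proof.
move=> hK kK hch hl; apply: tree_hom_exists => g.
have [||x|g' [<- <-]] := @tgen_exists _ T (h (tgen_out g)) (map h (tgen_ins g)).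
- by rewrite hl tgen_nonleaf.
- by rewrite (map_inj_uniq (can_inj hK)) tgen_uniq.
- by rewrite -(kK x) (mem_map (can_inj hK)) hch mem_tgen.
- exact: profile_gen.
Qed.

(** * Stars

    All trees that the proof needs are stars: the output and n further outer
    vertices are attached to a centre, and some of the outer vertices are
    inputs.  For n = 0 the centre is itself outer and may be the input; this
    gives the tree with one edge. *)

Section Star.
Variables (n : nat) (I : {set 'I_n.+2}).
Notation o := (lift ord0 ord0 : 'I_n.+2).
Hypotheses (I_out : o \notin I) (I_centre : ord0 \in I -> n = 0).

Definition star_adj : rel 'I_n.+2 := fun v w => (v == ord0) (+) (w == ord0).

Lemma star_adj_sym : symmetric star_adj.
Proof. by move=> v w; rewrite /star_adj addbC. Qed.

Lemma star_adj_irr : irreflexive star_adj.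
Proof. by move=> v; rewrite /star_adj addbb. Qed.

Lemma star_adj_connected v w : connect star_adj v w.
Proof.
have c0 u : connect star_adj u ord0.
  case: (eqVneq u ord0) => [->|u0]; first exact: connect0.
  by apply: connect1; rewrite /star_adj (negPf u0).
apply: connect_trans (c0 v) _.
by rewrite (sym_connect_sym star_adj_sym).
Qed.

Lemma star_adj_acyclic (c : seq 'I_n.+2) : ucycle star_adj c -> size c <= 2.
Proof.
case: c => [|x [|y [|z c]]] // /andP[/=].
rewrite /star_adj => /andP[xy /andP[yz zc]] /and4P[xN yN _ _].
move: xN yN; rewrite !inE !negb_or => /and3P[xy' xz _] /andP[yz' yc].
have [y0|y0] := eqVneq y ord0; last first.
  by move: xy yz xz; rewrite (negPf y0) addbF /= => /eqP -> /eqP ->; rewrite eqxx.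
move: xy yz; rewrite y0 eqxx addbT /= => x0 z0.
case: c zc yc => [|t c] /=; first by rewrite (negPf x0) (negPf z0).
by rewrite (negPf z0) /= inE y0 => /andP[/eqP ->]; rewrite eqxx.
Qed.

Lemma star_outer v : v != ord0 -> #|[set w | star_adj v w]| = 1.
Proof.
move=> v0; apply/eqP/cards1P; exists ord0; apply/setP => w.
by rewrite !inE /star_adj (negPf v0).
Qed.

Lemma star_ins_outer v : v \in I -> #|[set w | star_adj v w]| = 1.
Proof.
have [-> /I_centre n0|v0 _] := eqVneq v ord0; last exact: star_outer.
apply/eqP/cards1P; exists o; apply/setP => w; rewrite !inE /star_adj eqxx.
case: (unliftP ord0 w) => [j ->|->] //=.
have -> : j = ord0 by apply/val_inj/eqP; rewrite -leqn0 -n0 -ltnS ltn_ord.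
by rewrite eqxx.
Qed.

Definition star : tree 'I_n.+2 :=
  @Tree _ star_adj o I star_adj_sym star_adj_irr star_adj_connected
    star_adj_acyclic (star_outer (isT : o != ord0)) star_ins_outer I_out.

Lemma star_edges : exists (r : edge star) (l : 'I_n -> edge star),
  [/\ top r = ord0, forall i, top (l i) = lift ord0 (lift ord0 i),
      injective l, forall x, x = r \/ exists i, x = l i &
      forall x y, child x y <-> y = r /\ exists i, x = l i].
Proof.
have [r rE] : exists r : edge star, top r = ord0 by apply: top_surj.
have /choice[l lE] : forall i : 'I_n, exists x : edge star,
    top x = lift ord0 (lift ord0 i) by move=> i; apply: top_surj.
have r_or_l x : x = r \/ exists i, x = l i.
  case: (unliftP ord0 (top x)) => [j xj|x0]; last first.
    by left; apply: top_inj; rewrite rE.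
  case: (unliftP ord0 j) => [i ji|j0].
    by right; exists i; apply: top_inj; rewrite lE xj ji.
  by have := top_out x; rewrite xj j0 eqxx.
have par0 : par star ord0 = o.
  have : adj star ord0 o by [].
  by rewrite adjE eqxx andFb orbF => /andP[_ /eqP].
have parl i : par star (lift ord0 (lift ord0 i)) = ord0.
  have : adj star (lift ord0 (lift ord0 i)) ord0 by [].
  by rewrite adjE par0 andbC => /orP[/andP[/eqP]|/andP[_ /eqP/lift_inj]].
exists r, l; split=> // [i j lij|x y].
  by have := lE j; rewrite -lij lE => /lift_inj/lift_inj.
split=> [/eqP xy|[-> [i ->]]]; last by rewrite /child lE parl rE.
case: (r_or_l x) xy => [->|[i ->]] xy.
  by have := top_out y; rewrite -xy rE par0 eqxx.
split; last by exists i.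
by apply: top_inj; rewrite rE -xy lE parl.
Qed.

End Star.

Definition is_corolla (V : finType) (T : tree V) (ls : seq (edge T)) (r : edge T) :=
  [/\ uniq (r :: ls), forall x, x \in r :: ls, profile ls r &
      forall xs x, profile xs x -> xs = [:: x] \/ x = r /\ perm_eq xs ls].

(** All n outer vertices other than the output are inputs. *)
Lemma corolla_tree n : exists (t : tree 'I_n.+2) ls r,
  size ls = n /\ @is_corolla _ t ls r.
Proof.
pose I := [set lift ord0 (lift ord0 i) | i : 'I_n] : {set 'I_n.+2}.
have I_out : lift ord0 ord0 \notin I.
  by apply/negP => /imsetP[i _ /lift_inj/eqP]; rewrite (negPf (neq_lift _ _)).
have I_centre : ord0 \in I -> n = 0 by case/imsetP.
have [r [l [rE lE l_inj r_or_l ch]]] := star_edges I_out I_centre.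
set t := star _ _ in r l rE lE l_inj r_or_l ch.
have leaf_l i : leaf (l i) by rewrite /leaf lE; apply: imset_f.
have rl i : r != l i.
  by apply/eqP => E; have := rE; rewrite E lE.
have leaf_r : ~~ leaf r.
  by rewrite /leaf rE; apply/negP => /imsetP[].
have mem_codom_l x : x \in codom l <-> child x r.
  split=> [/codomP[i ->]|/ch[_ [i ->]]]; last exact: codom_f.
  by apply/ch; split=> //; exists i.
have codom_uniq : uniq (codom l) by apply/injectiveP.
have codom_r : r \notin codom l.
  by apply/negP => /codomP[i E]; have := rl i; rewrite -E eqxx.
exists t, (codom l), r; split; first by rewrite size_codom card_ord.
split.
- by rewrite /= codom_r.
- by move=> x; rewrite inE; case: (r_or_l x) => [->|[i ->]]; rewrite ?eqxx ?codom_f ?orbT.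
- have [||x|g [<- <-]] := @tgen_exists _ t r (codom l) => //.
    by apply/idP/idP => /mem_codom_l.
  exact: profile_gen.
- move=> xs x xsx; case: (r_or_l x) xsx => [->|[i ->]] xsx; last first.
    by left; have /leaf_profile/(_ _ xsx) := leaf_l i.
  have [|->|xsE] := profile_corolla _ xsx; [by move=> y /ch[_ [i ->]]|by left|right].
  split=> //; apply: uniq_perm => // [|y]; first exact: profile_uniq xsx.
  by rewrite xsE; apply/idP/idP => /mem_codom_l.
Qed.

Lemma eta_tree : exists (t : tree 'I_2) (r : edge t),
  (forall x, x = r) /\ forall (xs : seq (edge t)) x, profile xs x -> xs = [:: x].
Proof.
have I_out : lift ord0 ord0 \notin [set (ord0 : 'I_2)] by rewrite inE.
have I_centre : ord0 \in [set (ord0 : 'I_2)] -> 0 = 0 by [].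
have [r [l [rE _ _ r_or_l _]]] := star_edges I_out I_centre.
exists (star I_out I_centre), r.
have xr x : x = r by have [|[i _]] := r_or_l x; [|case: i].
split=> // xs x.
have /leaf_profile : leaf x by rewrite /leaf (xr x) rE inE.
exact.
Qed.

(** A binary vertex with a nullary vertex grafted on its second input. *)
Lemma stumped_tree : exists (t : tree 'I_4) (a b r : edge t),
  [/\ a <> r, profile [:: a; b] r & profile [::] b].
Proof.
pose i0 : 'I_2 := ord0; pose i1 : 'I_2 := lift ord0 ord0.
pose I := [set lift ord0 (lift ord0 i0)] : {set 'I_4}.
have I_out : lift ord0 ord0 \notin I by rewrite inE.
have I_centre : ord0 \in I -> 2 = 0 by rewrite inE.
have [r [l [rE lE l_inj r_or_l ch]]] := star_edges I_out I_centre.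
exists (star I_out I_centre), (l i0), (l i1), r; split.
- by move=> E; have := rE; rewrite -E lE.
- have [||x|g [<- <-]] := @tgen_exists _ (star I_out I_centre) r [:: l i0; l i1].
  + by rewrite /leaf rE inE.
  + by rewrite /= inE (inj_eq l_inj).
  + rewrite !inE; apply/idP/idP => [|/ch[_ [i ->]]].
      by case/orP=> /eqP->; apply/ch; split=> //; eexists.
    by rewrite !(inj_eq l_inj); case: i => [[|[]]].
  + exact: profile_gen.
- have [||x|g [<- <-]] := @tgen_exists _ (star I_out I_centre) (l i1) [::] => //.
  + by rewrite /leaf lE inE.
  + rewrite in_nil; apply/esym/negP => /ch[E _].
    by have := rE; rewrite -E lE.
  + exact: profile_gen.
Qed.

(** * Equivalences are fully faithful and essentially surjective *)

Section Equivalences.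
Variables (A B : category).

Lemma nat_isomorphicP (F G : functor A B) : nat_isomorphic F G ->
  exists (t : forall a, hom (F a) (G a)) (u : forall a, hom (G a) (F a)),
  [/\ forall a, u a \oc t a = idm _, forall a, t a \oc u a = idm _,
      forall a b (f : hom a b), t b \oc fmap F f = fmap G f \oc t a &
      forall a b (f : hom a b), u b \oc fmap G f = fmap F f \oc u a].
Proof.
move=> [t [u [ut tu]]]; exists (component t), (component u); split.
- by move=> a; have := congr1 (fun v => component v a) ut.
- by move=> a; have := congr1 (fun v => component v a) tu.
- exact: naturality.
- exact: naturality.
Qed.

End Equivalences.

Section FullyFaithful.
Variables (A B : category) (F : functor A B) (G : functor B A).

Lemma faithful_of_retract : nat_isomorphic (functor_comp G F) (functor_id A) ->
  forall (a b : A) (f g : hom a b), fmap F f = fmap F g -> f = g.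
Proof.
move=> /nat_isomorphicP[t [u [_ tu tn _]]] a b f g fg.
have E (h : hom a b) : h = t b \oc fmap G (fmap F h) \oc u a.
  by have /= -> := tn _ _ h; rewrite -cmpA tu cmpm1.
by rewrite (E f) (E g) fg.
Qed.

End FullyFaithful.

Lemma conj_cancel (A : category) (a b a' b' : A) (t : hom a' a) (u : hom a a')
    (t' : hom b' b) (u' : hom b b') (g h : hom a' b') :
  u \oc t = idm a' -> u' \oc t' = idm b' ->
  t' \oc g = (t' \oc h \oc u) \oc t -> g = h.
Proof.
move=> ut ut' /(congr1 (fun k => u' \oc k)).
by rewrite cmpA ut' cmp1m -!cmpA ut cmpm1 cmpA ut' cmp1m.
Qed.

Lemma full_of_equivalence (A B : category) (F : functor A B) :
  is_equivalence F ->
  forall (a b : A) (h : hom (F a) (F b)), exists f, fmap F f = h.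
Proof.
move=> [G [GF FG]] a b h.
have /nat_isomorphicP[t [u [ut tu tn un]]] := GF.
exists (t b \oc fmap G h \oc u a); apply: (faithful_of_retract FG).
exact: conj_cancel (ut a) (ut b) (tn _ _ _).
Qed.

Lemma faithful_of_equivalence (A B : category) (F : functor A B) :
  is_equivalence F ->
  forall (a b : A) (f g : hom a b), fmap F f = fmap F g -> f = g.
Proof. by move=> [G [GF _]]; apply: faithful_of_retract GF. Qed.

Definition isomorphic (A : category) (a b : A) : Prop :=
  exists (f : hom a b) (g : hom b a), g \oc f = idm a /\ f \oc g = idm b.

Lemma esssurj_of_equivalence (A B : category) (F : functor A B) :
  is_equivalence F -> forall b : B, exists a : A, isomorphic (F a) b.
Proof.
move=> [G [_ /nat_isomorphicP[t [u [ut tu _ _]]]]] b.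
exists (G b), (t b), (u b); split; [exact: ut|exact: tu].
Qed.

(** * Omega in terms of edges *)

Section EdgeMaps.
Implicit Types (c d : Omega).

Definition edges c : Type := edge (tagged (tree_repr c)).

HB.instance Definition _ c := Finite.on (edges c).

Definition op_profile c (xs : seq (edges c)) (x : edges c) : Prop :=
  @profile _ (tagged (tree_repr c)) xs x.

Definition emap c d (f : hom c d) : edges c -> edges d :=
  @hcol (Omega_operad c) (Omega_operad d) f.

Lemma emap_id c : emap (idm c) =1 id. Proof. by []. Qed.

Lemma emap_comp c d e (g : hom d e) (f : hom c d) x :
  emap (g \oc f) x = emap g (emap f x).
Proof. by []. Qed.

Lemma emap_inj c d (f g : hom c d) : emap f =1 emap g -> f = g.
Proof. exact: tree_hom_ext. Qed.

Lemma emap_profile c d (f : hom c d) xs x :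
  op_profile xs x -> op_profile (map (emap f) xs) (emap f x).
Proof. exact: hom_profile. Qed.

Lemma emap_exists c d (h : edges c -> edges d) :
  (forall xs x, op_profile xs x -> op_profile (map h xs) (h x)) ->
  exists f : hom c d, emap f = h.
Proof.
by move=> hP; apply: tree_hom_exists => g; apply/hP/profile_gen.
Qed.

(** Objects are isomorphism classes of trees, so it suffices to recover an
    isomorphism of trees from one of operads. *)
Lemma Omega_skeletal c d : isomorphic c d -> c = d.
Proof.
move=> [f [g [gf fg]]].
have fK : cancel (emap f) (emap g) by move=> x; rewrite -emap_comp gf.
have gK : cancel (emap g) (emap f) by move=> x; rewrite -emap_comp fg.
have fP := @emap_profile _ _ f; have gP := @emap_profile _ _ g.
rewrite -(reprK c) -(reprK d); apply/eqmodP/asboolP.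
exists (vertex_map (emap f)); split.
- by exists (vertex_map (emap g)); apply: vertex_mapK.
- exact: (vertex_map_adj fK gK fP gP).
- exact: vertex_map_out.
- exact: (vertex_map_ins fK gK fP gP).
Qed.

(** An object of Omega is computed on a chosen representative of its class; this
    gives access to it through any other tree of the class. *)
Lemma tree_realized n (t : tree 'I_n) :
  exists (c : Omega) (h : edge t -> edges c) (k : edges c -> edge t),
  [/\ cancel h k, cancel k h,
      forall xs x, profile xs x -> op_profile (map h xs) (h x) &
      forall xs x, op_profile xs x -> profile (map k xs) (k x)].
Proof.
pose c : Omega := (\pi_({eq_quot tree_iso_equiv_rel}%qT) (existT _ n t : ord_tree))%qT.
have : tree_iso (existT _ n t : ord_tree) (tree_repr c).
  by apply/asboolP; apply/(@eqmodP _ tree_iso_equiv_rel); rewrite reprK.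
case=> f [[g fK gK] /= fadj fout fins]; exists c.
have gadj v w : adj t (g v) (g w) = adj (tagged (tree_repr c)) v w.
  by rewrite -fadj !gK.
have gout : g (out (tagged (tree_repr c))) = out t by rewrite -fout fK.
have gins v : (g v \in ins t) = (v \in ins (tagged (tree_repr c))).
  by rewrite -fins gK.
have [h hE] := rename_exists fK fout.
have [k kE] := rename_exists gK gout.
have hK : cancel h k by move=> x; apply: top_inj; rewrite kE hE fK.
have kK : cancel k h by move=> x; apply: top_inj; rewrite hE kE gK.
exists h, k; split=> //.
- have hl x : leaf (h x) = leaf x by rewrite /leaf hE fins.
  have [phi <-] := rename_profile hK kK (rename_child fK fadj fout hE) hl.
  exact: hom_profile.
- have kl x : leaf (k x) = leaf x by rewrite /leaf kE gins.
  have [phi <-] := rename_profile kK hK (rename_child gK gadj gout kE) kl.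
  exact: hom_profile.
Qed.

End EdgeMaps.

(** * Corollas in Omega *)

Implicit Types c d : Omega.

Lemma uniq_map_inj (X Y : eqType) (f : X -> Y) (s : seq X) :
  uniq (map f s) -> {in s &, injective f}.
Proof.
move=> U x y xs ys E; rewrite -(nth_index x xs) -(nth_index x ys); congr nth.
by apply/eqP; rewrite -(nth_uniq (f x) _ _ U) ?size_map ?index_mem // !(nth_map x)
  ?index_mem // !nth_index // E.
Qed.

Definition vertexless c : Prop := forall (xs : seq (edges c)) x,
  op_profile xs x -> xs = [:: x].

Definition corolla c (ls : seq (edges c)) (r : edges c) : Prop :=
  @is_corolla _ (tagged (tree_repr c)) ls r.

Lemma vertexless_or c : vertexless c \/
  exists (xs : seq (edges c)) x, op_profile xs x /\ uniq (x :: xs).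
Proof. exact: tree_vertexless_or. Qed.

Lemma vertexless_edge c : vertexless c -> forall x y : edges c, x = y.
Proof.
move=> c0; have [r rP] := root_profile (tagged (tree_repr c)) => x y.
have E (z : edges c) : z = r.
  by have [xs xsr] := rP z; rewrite (c0 _ _ xsr) mem_seq1 => /eqP.
by rewrite (E x) (E y).
Qed.

Lemma emap_vertexless c d (f : hom c d) :
  injective (emap f) -> vertexless d -> vertexless c.
Proof.
move=> fI d0 xs x /(emap_profile f)/d0 E.
exact: (inj_map fI).
Qed.

Lemma vertexless_hom c d (y : edges d) : vertexless c ->
  exists f : hom c d, forall x, emap f x = y.
Proof.
move=> c0; have [|f fE] := @emap_exists c d (fun _ => y).
  by move=> xs x /c0 -> /=; apply: profile_id.
by exists f => x; rewrite fE.
Qed.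

(** The generators of a corolla are the reorderings of one operation, so that
    morphisms from it are operations of d. *)
Lemma corolla_hom c d (ls : seq (edges c)) r (xs : seq (edges d)) x :
  corolla ls r -> op_profile xs x -> size xs = size ls ->
  exists f : hom c d, map (emap f) ls = xs /\ emap f r = x.
Proof.
move=> [/= /andP[rls lsU] _ _ cP] xsx sz.
pose h y := if y == r then x else nth x xs (index y ls).
have hls : map h ls = xs.
  apply: (@eq_from_nth _ x) => [|i]; first by rewrite size_map.
  rewrite size_map => ilt; rewrite (nth_map r) // /h index_uniq //.
  by case: eqP => // E; case/negP: rls; rewrite -E mem_nth.
have hr : h r = x by rewrite /h eqxx.
have [|f fE] := @emap_exists c d h; last by exists f; rewrite fE.
move=> ys y /cP[->|[-> ysls]]; first exact: profile_id.
by rewrite hr; apply: (profile_perm _ xsx); rewrite -hls perm_sym perm_map.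
Qed.

Lemma corolla_exists n : exists c (ls : seq (edges c)) r, size ls = n /\ corolla ls r.
Proof.
have [t [ls [r [lsn [U ar lsr cP]]]]] := corolla_tree n.
have [c [h [k [hK kK hP kP]]]] := tree_realized t.
have hI := can_inj hK; have kI := can_inj kK.
exists c, (map h ls), (h r); split; first by rewrite size_map.
split.
- by rewrite -map_cons map_inj_uniq.
- by move=> x; rewrite -(kK x) -map_cons mem_map.
- exact: hP.
- move=> xs x /kP/cP[E|[E p]]; [left|right].
    by apply: (inj_map kI).
  split; first by rewrite -E kK.
  by apply: (perm_map_inj kI); rewrite mapK.
Qed.

Lemma vertexless_exists : exists c, vertexless c /\ inhabited (edges c).
Proof.
have [t [r [_ tP]]] := eta_tree.
have [c [h [k [hK kK hP kP]]]] := tree_realized t.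
exists c; split; last by split; apply: h r.
by move=> xs x /kP/tP E; apply: (inj_map (can_inj kK)).
Qed.

Lemma stumped_exists : exists c (a b r : edges c),
  [/\ a <> r, op_profile [:: a; b] r & op_profile [::] b].
Proof.
have [t [a [b [r [ar abr b0]]]]] := stumped_tree.
have [c [h [k [hK kK hP kP]]]] := tree_realized t.
exists c, (h a), (h b), (h r); split; [by move/(can_inj hK)|exact: hP abr|exact: hP b0].
Qed.

(** * Autoequivalences preserve profiles *)

Section Autoequivalence.
Variables (eta : Omega) (pt : edges eta).
Hypothesis eta0 : vertexless eta.

Lemma eta_pt x : x = pt. Proof. exact: vertexless_edge. Qed.

Lemma point_exists c (x : edges c) : exists f : hom eta c, emap f pt = x.
Proof. by have [f fE] := vertexless_hom x eta0; exists f. Qed.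

Definition point c (x : edges c) : hom eta c := sval (cid (point_exists x)).

Lemma pointE c (x : edges c) : emap (point x) pt = x.
Proof. exact: (svalP (cid (point_exists x))). Qed.

Lemma eta_hom_ext c (f g : hom eta c) : emap f pt = emap g pt -> f = g.
Proof. by move=> E; apply: emap_inj => x; rewrite (eta_pt x). Qed.

(** Naturality with respect to the morphisms from eta, where t is trivial. *)
Lemma nat_id_unique (t : forall c, hom c c) :
  (forall c d (f : hom c d), t d \oc f = f \oc t c) -> forall c, t c = idm c.
Proof.
move=> tn c; apply: emap_inj => x; rewrite emap_id -{1}(pointE x) -emap_comp tn.
by rewrite emap_comp (eta_pt (emap _ pt)) pointE.
Qed.

Variable F : functor Omega Omega.
Hypothesis F_equiv : is_equivalence F.

Let F_faithful := faithful_of_equivalence F_equiv.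
Let F_full := full_of_equivalence F_equiv.
Let F_esssurj := esssurj_of_equivalence F_equiv.

(** F eta maps to every object, in particular there is p from F eta to eta.
    With i from eta to F eta, the composite i p is an endomorphism of F eta, and
    like eta this has only one. *)
Lemma F_eta : isomorphic eta (F eta).
Proof.
have [c [f [_ _]]] := F_esssurj eta.
have [r _] := root_profile (tagged (tree_repr c)).
pose p := f \oc fmap F (point (r : edges c)).
have [r' _] := root_profile (tagged (tree_repr (F eta))).
pose i := point (r' : edges (F eta)).
exists i, p; split; first by apply: eta_hom_ext; apply: vertexless_edge.
have [chi <-] := F_full (i \oc p); rewrite (_ : chi = idm eta) ?fmap1 //.
by apply: eta_hom_ext; apply: vertexless_edge.
Qed.

Variables (i : hom eta (F eta)) (p : hom (F eta) eta).
Hypotheses (p_i : p \oc i = idm eta) (i_p : i \oc p = idm (F eta)).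

(** An edge is a morphism from eta; F, corrected by the isomorphism of eta with
    F eta, acts on these. *)
Definition edge_bij c (x : edges c) : edges (F c) := emap (fmap F (point x) \oc i) pt.

Lemma edge_bij_nat c d (f : hom c d) x : emap (fmap F f) (edge_bij x) = edge_bij (emap f x).
Proof.
rewrite /edge_bij -emap_comp cmpA -fmapM; congr (emap (fmap F _ \oc i) pt).
by apply: eta_hom_ext; rewrite emap_comp !pointE.
Qed.

Lemma edge_bij_inj c : injective (@edge_bij c).
Proof.
move=> x y /eta_hom_ext E; suff : point x = point y.
  by rewrite -{2}(pointE x) => ->; rewrite pointE.
apply: F_faithful; have := congr1 (fun f => f \oc p) E.
by rewrite -!cmpA i_p !cmpm1.
Qed.

Lemma edge_bij_surj c (y : edges (F c)) : exists x, edge_bij x = y.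
Proof.
have [f fE] := F_full (point y \oc p); exists (emap f pt).
rewrite /edge_bij (_ : point _ = f) ?fE; last by apply: eta_hom_ext; rewrite pointE.
by rewrite -cmpA p_i cmpm1 pointE.
Qed.

(** The vertexless objects are those with a single edge and a morphism to eta,
    a condition that equivalences transport. *)
Lemma F_vertexless c : vertexless (F c) <-> vertexless c.
Proof.
split=> c0.
  have [f _] := vertexless_hom (emap i pt) c0; have [g gE] := F_full f.
  apply: (emap_vertexless (f := g) _ eta0) => x y _.
  by apply: edge_bij_inj; apply: vertexless_edge.
have [f _] := vertexless_hom pt c0.
apply: (emap_vertexless (f := p \oc fmap F f) _ eta0) => x y _.
have [x' <-] := edge_bij_surj x; have [y' <-] := edge_bij_surj y.
by rewrite (vertexless_edge c0 x' y').
Qed.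

Lemma corolla_not_vertexless c (ls : seq (edges c)) r : corolla ls r -> ~ vertexless c.
Proof.
by move=> [U _ lsr _] /(_ _ _ lsr) E; move: U; rewrite E /= mem_seq1 eqxx.
Qed.

(** F c has a vertex, whose corolla m embeds into F c by f.  Up to isomorphism
    m is F d, and f comes from an embedding chi of d into c.  As d has a vertex
    and c is a corolla, chi is onto on edges, hence so is f. *)
Lemma F_corolla_profile c (ls : seq (edges c)) r : corolla ls r ->
  exists (xs : seq (edges (F c))) x,
  [/\ op_profile xs x, uniq (x :: xs) & forall y, y \in x :: xs].
Proof.
move=> cor; have [U all_c lsr cP] := cor.
case: (vertexless_or (F c)) => [/F_vertexless/(corolla_not_vertexless cor)//|].
move=> [xs [x [xsx xU]]]; exists xs, x; split=> // y.
have [m [ls' [r' [ls'n cor']]]] := corolla_exists (size xs).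
have [f [fls fr]] := corolla_hom cor' xsx (esym ls'n).
have [U' all_m _ _] := cor'.
have fI : injective (emap f).
  by move=> u v; apply: (@uniq_map_inj _ _ _ (r' :: ls')); rewrite ?all_m //= fls fr.
have [d [j [j' [j'j jj']]]] := F_esssurj m.
have jI : injective (emap j).
  by apply: (can_inj (g := emap j')) => z; rewrite -emap_comp j'j.
have j'I : injective (emap j').
  by apply: (can_inj (g := emap j)) => z; rewrite -emap_comp jj'.
have [chi chiE] := F_full (f \oc j).
have chiI : injective (emap chi).
  move=> u v E; apply: edge_bij_inj; apply: jI; apply: fI.
  by rewrite -!(emap_comp f j) -chiE !edge_bij_nat E.
have [d0|[ys [z [ysz zU]]]] := vertexless_or d.
  by case: (corolla_not_vertexless cor'); apply: emap_vertexless j'I _; apply/F_vertexless.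
have chi_surj w : exists w', emap chi w' = w.
  have [E|[zr ysls]] := cP _ _ (emap_profile chi ysz).
    have {}E : ys = [:: z] by apply: (inj_map chiI).
    by move: zU; rewrite E /= mem_seq1 eqxx.
  have : w \in map (emap chi) (z :: ys) by rewrite /= inE (perm_mem ysls) zr -in_cons.
  by case/mapP=> w' _ ->; exists w'.
have [w <-] := edge_bij_surj y; have [w' <-] := chi_surj w.
rewrite -edge_bij_nat chiE emap_comp -fr -fls -map_cons mem_map //.
Qed.

Lemma F_corolla_root c (ls : seq (edges c)) r (xs : seq (edges (F c))) x :
  corolla ls r -> op_profile xs x -> uniq (x :: xs) ->
  (forall y, y \in x :: xs) -> x = edge_bij r -> op_profile (map (@edge_bij c) ls) (edge_bij r).
Proof.
move=> [U all_c _ _] xsx xU all_x xr; rewrite -xr; apply: profile_perm xsx.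
have U' : uniq (edge_bij r :: map (@edge_bij c) ls) by rewrite -map_cons (map_inj_uniq (@edge_bij_inj c)).
have all' y : y \in edge_bij r :: map (@edge_bij c) ls.
  by have [y' <-] := edge_bij_surj y; rewrite -map_cons (mem_map (@edge_bij_inj c)).
move: xU U'; rewrite -xr /= => /andP[xN xU] /andP[rN U']; apply: uniq_perm => // y.
have := all_x y; have := all' y; rewrite -xr !inE.
have [->|_ /= -> -> //] := eqVneq y x.
by rewrite (negPf xN) (negPf rN).
Qed.

(** Suppose that the output of the operation through all edges of F c comes
    from a leaf y of c, and that there is another leaf z.  The automorphism of
    c which exchanges y and z moves that operation to one with output z, which
    has y as an input, while the original one has output y and z as an input.
    This contradicts antisymmetry. *)
Lemma F_corolla_root_or c (ls : seq (edges c)) r (xs : seq (edges (F c))) x :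
  corolla ls r -> op_profile xs x -> uniq (x :: xs) ->
  (forall y, y \in x :: xs) -> x = edge_bij r \/ exists2 y, ls = [:: y] & x = edge_bij y.
Proof.
move=> cor xsx xU all_x; have [/= /andP[rls lsU] all_c lsr cP] := cor.
have [y yx] := edge_bij_surj x; have := all_c y.
rewrite inE => /orP[/eqP yr|yls]; first by left; rewrite -yx yr.
right; have [lsy|[z zls zy]] : ls = [:: y] \/ exists2 z, z \in ls & z != y.
- case: ls {cor rls all_c lsr cP} lsU yls => [|u [|v ls]] //=.
    by rewrite mem_seq1 => _ /eqP ->; left.
  move=> /andP[uN _] _; right; case: (eqVneq u y) => [uy|]; last by exists u; rewrite ?mem_head.
  exists v; first by rewrite !inE eqxx orbT.
  by move: uN; rewrite inE negb_or uy eq_sym => /andP[].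
- by exists y.
pose s u := if u == y then z else if u == z then y else u.
have sK : involutive s.
  move=> u; rewrite /s; case: (eqVneq u y) => [->|uy]; first by rewrite (negPf zy) eqxx.
  by case: (eqVneq u z) => [->|uz]; rewrite ?eqxx // (negPf uy) (negPf uz).
have sls u : u \in ls -> s u \in ls by rewrite /s; case: eqP => // _; case: eqP.
have sP : perm_eq ls (map s ls).
  apply: uniq_perm => // [|u]; first by rewrite (map_inj_uniq (inv_inj sK)).
  apply/idP/mapP => [/sls uls|[v /sls vls ->] //].
  by exists (s u); rewrite ?sK.
have [a [als _]] := corolla_hom cor (profile_perm sP lsr) (size_map _ _).
have aE u : u \in ls -> emap a u = s u by move: u; apply/eq_in_map.
have ay : emap a y = z by rewrite aE // /s eqxx.
have az : emap a z = y by rewrite aE // /s (negPf zy) eqxx.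
have bzx : edge_bij z != x by rewrite -yx (inj_eq (@edge_bij_inj c)).
have zxs : edge_bij z \in xs by have := all_x (edge_bij z); rewrite inE (negPf bzx).
have := emap_profile (fmap F a) xsx; rewrite -{1}yx edge_bij_nat ay => xsz.
case/eqP: bzx; apply: (profile_antisym xsz _ xsx zxs).
by rewrite -yx -az -edge_bij_nat map_f.
Qed.

(** The remaining case is a unary corolla that F could reverse.  In the tree w
    with edges a, b, r', the operation (a; r') is composed from (a, b; r') and
    (; b), whose directions F preserves by the other cases; if F reversed the
    unary corolla, then F w would also have the opposite operation. *)
Lemma F_corolla c (ls : seq (edges c)) r :
  corolla ls r -> op_profile (map (@edge_bij c) ls) (edge_bij r).
Proof.
have not1 d (ks : seq (edges d)) q : size ks != 1 -> corolla ks q ->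
    op_profile (map (@edge_bij d) ks) (edge_bij q).
  move=> n1 cor; have [xs [x [xsx xU all_x]]] := F_corolla_profile cor.
  case: (F_corolla_root_or cor xsx xU all_x) => [xr|[y ksy _]].
    exact: (F_corolla_root cor xsx).
  by rewrite ksy in n1.
move=> cor; have [xs [x [xsx xU all_x]]] := F_corolla_profile cor.
case: (F_corolla_root_or cor xsx xU all_x) => [xr|[y lsy xy]].
  exact: (F_corolla_root cor xsx).
have [w [a [b [r' [ar abr b0]]]]] := stumped_exists.
have image d (ks : seq (edges d)) q (us : seq (edges w)) u : size ks != 1 ->
    corolla ks q -> op_profile us u -> size us = size ks ->
    op_profile (map (@edge_bij w) us) (edge_bij u).
  move=> n1 ckq usu sz; have [f [<- <-]] := corolla_hom ckq usu sz.
  have := emap_profile (fmap F f) (not1 _ _ _ n1 ckq).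
  by rewrite edge_bij_nat -map_comp (eq_map (edge_bij_nat f)) map_comp.
have [c2 [ls2 [r2 [n2 cor2]]]] := corolla_exists 2.
have [c0 [ls0 [r0 [n0 cor0]]]] := corolla_exists 0.
have Fabr : op_profile [:: edge_bij a; edge_bij b] (edge_bij r').
  by apply: (image _ _ _ _ _ _ cor2 abr); rewrite n2.
have Fb : op_profile [::] (edge_bij b).
  by apply: (image _ _ _ _ _ _ cor0 b0); rewrite n0.
have Far := profile_graft (xs := [:: edge_bij a]) Fabr Fb.
have arw := profile_graft (xs := [:: a]) abr b0.
have [f [fls fr]] := corolla_hom cor arw (esym (congr1 size lsy)).
have fy : emap f y = a by move: fls; rewrite lsy => -[].
have rN : edge_bij r != x.
  rewrite xy (inj_eq (@edge_bij_inj c)); case: cor => /=; rewrite lsy mem_seq1 andbT.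
  by [].
have rxs : edge_bij r \in xs by have := all_x (edge_bij r); rewrite inE (negPf rN).
have := emap_profile (fmap F f) xsx; rewrite xy edge_bij_nat fy => Fxs.
case: ar; apply: edge_bij_inj; apply: (profile_antisym Fxs _ Far); last by rewrite mem_seq1.
by rewrite -fr -edge_bij_nat map_f.
Qed.

Lemma edge_bij_profile c (xs : seq (edges c)) x :
  op_profile xs x -> op_profile (map (@edge_bij c) xs) (edge_bij x).
Proof.
move=> xsx; have [d [ls [r [n cor]]]] := corolla_exists (size xs).
have [f [<- <-]] := corolla_hom cor xsx (esym n).
have := emap_profile (fmap F f) (F_corolla cor).
by rewrite edge_bij_nat -map_comp (eq_map (edge_bij_nat f)) map_comp.
Qed.

End Autoequivalence.

Lemma autoequivalence_nat (F : functor Omega Omega) : is_equivalence F ->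
  exists t : forall c, hom c (F c),
  (forall c d (f : hom c d), t d \oc f = fmap F f \oc t c) /\
  (forall c (y : edges (F c)), exists x, emap (t c) x = y).
Proof.
move=> hF; have [eta [eta0 [pt]]] := vertexless_exists.
have [i [p [p_i i_p]]] := F_eta pt eta0 hF.
have tP : forall c, exists f : hom c (F c), emap f = edge_bij pt eta0 i (c := c).
  by move=> c; apply: emap_exists => xs x; exact: (edge_bij_profile pt eta0 hF p_i i_p).
pose t c := sval (cid (tP c)).
have tE c : emap (t c) = edge_bij pt eta0 i (c := c) := svalP (cid (tP c)).
exists t; split=> [c d f|c y].
- by apply: emap_inj => x; rewrite !emap_comp !tE edge_bij_nat.
- by rewrite tE; apply: (edge_bij_surj pt eta0 hF p_i).
Qed.

Lemma Omega_nat_id_unique (t : forall c, hom c c) :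
  (forall c d (f : hom c d), t d \oc f = f \oc t c) -> forall c, t c = idm c.
Proof. by have [eta [eta0 [pt]]] := vertexless_exists; apply: (nat_id_unique pt). Qed.

(** The transformations t for F and t' for a quasi-inverse G compose to an
    endotransformation of the identity, so t has a left inverse u; it is also a
    right inverse because t is bijective on edges. *)
Lemma autoequivalence_nat_iso (F : functor Omega Omega) : is_equivalence F ->
  exists (t : forall c, hom c (F c)) (u : forall c, hom (F c) c),
  [/\ forall c, u c \oc t c = idm c, forall c, t c \oc u c = idm (F c) &
      forall c d (f : hom c d), t d \oc f = fmap F f \oc t c].
Proof.
move=> hF; have [t [tn tS]] := autoequivalence_nat hF.
have [G [GF FG]] := hF.
have hG : is_equivalence G by exists F.
have [t' [tn' _]] := autoequivalence_nat hG.
have [v [_ [_ _ vn _]]] := nat_isomorphicP GF.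
pose u c : hom (F c) c := v c \oc t' (F c).
have ut c : u c \oc t c = idm c.
  apply: (Omega_nat_id_unique (t := fun c => u c \oc t c)) => {}c d f.
  rewrite -[LHS]cmpA tn /u !cmpA -(cmpA (v d)) tn' cmpA.
  by have /= -> := vn _ _ f.
exists t, u; split=> // c; apply: emap_inj => y.
by have [x <-] := tS c y; rewrite -!(emap_comp _ (t c)) -cmpA ut cmpm1 cmp1m.
Qed.

(** * From natural isomorphisms to the isomorphism of categories *)

Lemma functor_ext_thin (A B : category) (F G : functor A B) :
  (forall (a b : B) (f g : hom a b), f = g) -> fob F =1 fob G -> F = G.
Proof.
case: F G => [Fo Fm F1 FM] [Go Gm G1 GM] thin /= /funext E.
case: _ / E in Gm G1 GM *.
have E : Fm = Gm.
  by apply: functional_extensionality_dep => a; apply: functional_extensionality_dep => b;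
     apply: funext => f; apply: thin.
by case: _ / E in G1 GM *; congr Functor; apply: Prop_irrelevance.
Qed.

(** The identity on objects holds only propositionally; once it is eliminated,
    the components of t are automorphisms, and naturality is the formula for
    F_sigma. *)
Lemma functor_Fsigma (A : category) (F : functor A A)
    (t : forall a, hom a (F a)) (u : forall a, hom (F a) a) :
  (forall a, u a \oc t a = idm a) -> (forall a, t a \oc u a = idm (F a)) ->
  (forall a b (f : hom a b), t b \oc f = fmap F f \oc t a) ->
  fob F =1 id -> exists s : Sigma A, Fsigma s = F.
Proof.
case: F t u => [Fo Fm F1 FM] /= t u ut tu tn /funext E.
have {}E : (fun a => a) = Fo by rewrite E.
case: _ / E in Fm F1 FM t u ut tu tn *.
exists (fun a => MkAut (ut a) (tu a)).
have E : (fun a b (f : hom a b) => t b \oc f \oc u a) = Fm.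
  apply: functional_extensionality_dep => a; apply: functional_extensionality_dep => b.
  by apply: funext => f; rewrite tn -cmpA tu cmpm1.
case: _ / E in F1 FM tn *; rewrite /Fsigma.
by congr Functor; apply: Prop_irrelevance.
Qed.

(** The proof e is a parameter, so that it can be [erefl] when the object maps of
    F and G are convertible. *)
Lemma fmap_eq (A B : category) (F G : functor A B) (FG : F = G)
    (e : fob F = fob G) (a b : A) (f : hom a b) :
  eq_rect _ (fun o : A -> B => hom (o a) (o b)) (fmap F f) _ e = fmap G f.
Proof. by case: _ / FG in e *; rewrite (Prop_irrelevance e erefl). Qed.

Lemma aut_ext (A : category) (a : A) (x y : aut a) :
  aut_val x = aut_val y -> x = y.
Proof.
case: x y => [v i iv vi] [w j jw wj] /= vw; case: _ / vw in jw wj *.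
have ij : i = j by rewrite -(cmpm1 i) -wj cmpA iv cmp1m.
by case: _ / ij in jw wj *; congr MkAut; apply: Prop_irrelevance.
Qed.

(** These two properties alone make the canonical functor an isomorphism: the
    first one implies that there is only one transformation between any two
    F_sigma, and hence that sigma is determined by F_sigma; by the second one
    these are all the objects. *)
Section RigidCategory.
Variable A : category.
Hypothesis nat_id_trivial : forall t : forall a : A, hom a a,
  (forall a b (f : hom a b), t b \oc f = f \oc t a) -> forall a, t a = idm a.
Hypothesis every_Fsigma : forall F : functor A A, is_equivalence F ->
  exists s : Sigma A, Fsigma s = F.

(** Conjugation by s and s' turns t into an endotransformation of the identity. *)
Lemma sigma_iso_unique (s s' : Sigma A) (t : nat_trans (Fsigma s) (Fsigma s')) :
  t = sigma_iso s s'.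
Proof.
pose u a : hom a a := aut_inv (s' a) \oc (t a \oc s a).
have u1 : forall a, u a = idm a.
  apply: nat_id_trivial => a b f.
  have tf : t b \oc (s b \oc f \oc aut_inv (s a)) =
            s' b \oc f \oc aut_inv (s' a) \oc t a := naturality t f.
  have -> : u b \oc f = aut_inv (s' b) \oc
      (t b \oc (s b \oc f \oc aut_inv (s a))) \oc s a.
    by rewrite /u -!cmpA aut_mulVm cmpm1.
  by rewrite tf /u !cmpA aut_mulVm cmp1m.
apply: nat_trans_ext => a /=.
have := congr1 (fun k => s' a \oc k \oc aut_inv (s a)) (u1 a).
by rewrite /u cmpm1 => <-; rewrite !cmpA aut_mulmV cmp1m -cmpA aut_mulmV cmpm1.
Qed.

Lemma canonical_functor_surj (F : Aut A) : exists s, canonical_functor A s = F.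
Proof.
case: F => F hF; have [s sF] := every_Fsigma hF.
by exists s; apply: eq_exist.
Qed.

Lemma Aut_thin (F G : Aut A) (f g : hom F G) : f = g.
Proof.
have [s sF] := canonical_functor_surj F; have [s' sG] := canonical_functor_surj G.
case: _ / sF in f g *; case: _ / sG in f g *.
by rewrite (sigma_iso_unique f) (sigma_iso_unique g).
Qed.

(** If F_s = F_s', then the identities form a transformation between them, which
    by uniqueness has the components s'_a s_a^-1. *)
Lemma canonical_functor_inj : injective (canonical_functor A).
Proof.
move=> s s' E; have {}E : Fsigma s = Fsigma s' := congr1 sval E.
apply: functional_extensionality_dep => a; apply: aut_ext.
have nP (b b' : A) (f : hom b b') :
    idm b' \oc fmap (Fsigma s) f = fmap (Fsigma s') f \oc idm b.
  by rewrite cmp1m cmpm1; apply: (fmap_eq E erefl).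
have := sigma_iso_unique (@NatTrans _ _ (Fsigma s) (Fsigma s') (fun b => idm b) nP).
move=> /(congr1 (fun t : nat_trans (Fsigma s) (Fsigma s') => (t a : hom a a) \oc s a)) /=.
by rewrite cmp1m -cmpA aut_mulVm cmpm1.
Qed.

Lemma canonical_functor_iso : iso_of_categories (canonical_functor A).
Proof.
pose r (F : Aut A) : Sigma A := sval (cid (canonical_functor_surj F)).
have rK F : canonical_functor A (r F) = F := svalP (cid (canonical_functor_surj F)).
exists (@Functor (Aut A) (contr (Sigma A)) r (fun _ _ _ => tt)
          (fun _ => erefl) (fun _ _ _ _ _ => erefl)).
split; apply: functor_ext_thin => //=.
- by move=> a b [] [].
- by move=> s; apply: canonical_functor_inj; apply: rK.
- exact: Aut_thin.
Qed.

Lemma Aut_contractible : contractible_groupoid (Aut A).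
Proof.
have m (F G : Aut A) : exists f : hom F G, True.
  have [s <-] := canonical_functor_surj F; have [s' <-] := canonical_functor_surj G.
  by exists (sigma_iso s s').
split=> [F G f|].
  by have [g _] := m G F; exists g; split; apply: Aut_thin.
pose mor (F G : Aut A) : hom F G := sval (cid (m F G)).
exists (@Functor (Aut A) terminal (fun _ => tt) (fun _ _ _ => tt)
          (fun _ => erefl) (fun _ _ _ _ _ => erefl)).
pose I : Aut A := canonical_functor A (fun a => MkAut (cmp1m (idm a)) (cmp1m (idm a))).
pose G : functor terminal (Aut A) := @Functor terminal (Aut A) (fun _ => I)
  (fun _ _ _ => idm I) (fun _ => erefl) (fun _ _ _ _ _ => esym (cmp1m (idm I))).
exists G; split.
  pose iso H K : nat_trans H K :=
    @NatTrans (Aut A) (Aut A) H K (fun F => mor (H F) (K F))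
      (fun _ _ _ => Aut_thin _ _).
  exists (iso _ _), (iso _ _).
  by split; apply: nat_trans_ext => F; apply: Aut_thin.
have tt_eq (x y : unit) : x = y by case: x; case: y.
pose iso H K : nat_trans H K :=
  @NatTrans terminal terminal H K (fun _ => tt) (fun _ _ _ => tt_eq _ _).
exists (iso _ _), (iso _ _).
by split; apply: nat_trans_ext => x; apply: tt_eq.
Qed.

End RigidCategory.

Theorem theorem5p5p6 :
  iso_of_categories (canonical_functor Omega) /\
  contractible_groupoid (Aut Omega).
Proof.
have every_Fsigma (F : functor Omega Omega) : is_equivalence F ->
    exists s : Sigma Omega, Fsigma s = F.
  move=> /autoequivalence_nat_iso[t [u [ut tu tn]]].
  apply: (functor_Fsigma ut tu tn) => c.
  by apply/esym/Omega_skeletal; exists (t c), (u c).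
split; first exact: canonical_functor_iso Omega_nat_id_unique every_Fsigma.
exact: Aut_contractible Omega_nat_id_unique every_Fsigma.
Qed.
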